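(* Isomorphism classes of indecomposable objects in $\overline{\mathcal{C}}=\overline{\mathcal{C}}_{(S,M)}$ are in bijection with arcs in $(S,\overline{M})$, where $\overline{M}=M\cup\mathrm{acc}(M)$ is the closure of $M$.
   Context: Setting. Let $k$ be an algebraically closed field and $S$ a closed disk whose boundary circle $\partial S$ is oriented counter-clockwise. $M\subset\partial S$ is an infinite set of marked points with set of accumulation points $\mathrm{acc}(M)\subset\partial S$. Assume $M$ is discrete (every $m\in M$ has a neighbourhood meeting $M$ only in $m$), and $\mathrm{acc}(M)=\{z_1,\dots,z_n\}$ is finite with every $z_i$ two-sided (a limit of sequences of pairwise distinct points of $M$ from both sides). Let $S'$ be the disk obtained by replacing each $z_i$ by an ''added'' interval $[z_i^-,z_i^+]$ containing new points $z_{ij}\in(z_i^-,z_i^+)$, $j\in\mathbb{Z}$, increasing counter-clockwise in $j$, with $\lim_{j\to\pm\infty}z_{ij}=z_i^{\pm}$; put $M'=M\cup\{z_{ij}\}$. $M'$ is again discrete with finitely many accumulation points, all two-sided. For $m\in M'$ let $\sigma(m)$ (resp. $\sigma^{-}(m)$) be the next point of $M'$ in clockwise (resp. counter-clockwise) direction. An arc of $(S',M')$ is a pair $\{a,b\}$ of distinct non-neighbouring points of $M'$ (pairs of neighbours are boundary segments and are identified with the zero object). Two arcs cross if their four endpoints are distinct and alternate on the circle. The category $\mathcal{C}=\mathcal{C}_{(S',M')}$ is the Igusa–Todorov discrete cluster category of type $\mathbb{A}$: a Hom-finite Krull–Schmidt 2-Calabi–Yau triangulated $k$-category with suspension $[1]$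 whose isoclasses of indecomposables $X$ are in bijection with arcs $\ell_X$; if $\ell_X=\{a,b\}$ then $\ell_{X[1]}=\{\sigma(a),\sigma(b)\}$; $\mathrm{Hom}(X,Y[1])$ is $k$ if $\ell_X,\ell_Y$ cross and $0$ otherwise; and for $a_1,a_2,a_3,a_4$ in counter-clockwise order, with $\ell_X=\{a_1,a_3\}$, $\ell_Y=\{a_2,a_4\}$, $\ell_A=\{a_1,a_2\}$, $\ell_B=\{a_2,a_3\}$, $\ell_C=\{a_3,a_4\}$, $\ell_D=\{a_4,a_1\}$, there are non-split exact triangles $X\to B\oplus D\to Y\to X[1]$ and $Y\to A\oplus C\to X\to Y[1]$. Let $\mathcal{D}\subset\mathcal{C}$ be the full additive subcategory generated by indecomposables whose arcs have both endpoints in one interval $(z_i^-,z_i^+)$ (a thick subcategory), $\Sigma$ the class of morphisms of $\mathcal{C}$ with cone in $\mathcal{D}$, and $\overline{\mathcal{C}}=\mathcal{C}[\Sigma^{-1}]$ the Verdier quotient. An arc of $(S,\overline{M})$ is a pair of distinct points of $\overline{M}$ that is not a pair of neighbouring points of $M$. *)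

(* Defs.v *)
From HB Require Import structures.
From mathcomp Require Import all_boot all_order all_algebra.
From mathcomp Require Import all_classical all_reals all_analysis.
Import Order.TTheory GRing.Theory Num.Theory numFieldNormedType.Exports.

Set Implicit Arguments.
Unset Strict Implicit.
Unset Printing Implicit Defensive.

Local Open Scope classical_set_scope.
Local Open Scope ring_scope.

(** * Marked points and arcs *)

(* A cyclic order is a ternary relation: [cyc a b c] says that a, b, c are
   pairwise distinct and met in this order when travelling counter-clockwise. *)
Section CyclicOrder.
Variables (T : Type) (cyc : T -> T -> T -> Prop).

Definition next_ccw (A : set T) (a b : T) : Prop :=
  [/\ A a, A b, a <> b & forall c, A c -> ~ cyc a c b].

Definition neighbours (A : set T) (a b : T) : Prop :=
  next_ccw A a b \/ next_ccw A b a.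

(* Pairs of distinct points of P which are not neighbouring points of A. *)
Definition arcs (A P : set T) : set (set T) :=
  [set l | exists a b,
    [/\ P a, P b, a <> b, ~ neighbours A a b & l = [set a; b]]].

Definition cyc4 (a1 a2 a3 a4 : T) : Prop := cyc a1 a2 a3 /\ cyc a1 a3 a4.

Definition crosses (l l' : set T) : Prop :=
  exists a1 a2 a3 a4,
    [/\ cyc4 a1 a2 a3 a4, l = [set a1; a3] & l' = [set a2; a4]].
End CyclicOrder.

(** * The disks S and S' *)

Section Disk.
Variable R : realType.
Local Notation pt := (R * R)%type.

(* S is the closed unit disk. *)
Definition circle : set pt := [set p | p.1 ^+ 2 + p.2 ^+ 2 = 1].

(* On the circle, a, b, c are in strict counter-clockwise order if and only if
   the triangle abc is positively oriented. *)
Definition ccw (a b c : pt) : Prop :=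
  0 < (b.1 - a.1) * (c.2 - a.2) - (b.2 - a.2) * (c.1 - a.1).

(* The sign of det(z, u) tells on which of the two half circles bounded by z
   and its antipode the point u lies. *)
Definition ccw_side (z u : pt) : Prop := 0 < z.1 * u.2 - z.2 * u.1.
Definition cw_side (z u : pt) : Prop := z.1 * u.2 - z.2 * u.1 < 0.

Definition limit_from (side : pt -> pt -> Prop) (M : set pt) (z : pt) : Prop :=
  exists u : nat -> pt,
    [/\ injective u, forall n, M (u n), forall n, side z (u n)
      & u n @[n --> \oo] --> z].

Definition two_sided (M : set pt) (z : pt) : Prop :=
  limit_from ccw_side M z /\ limit_from cw_side M z.

Definition admissible_marking (M : set pt) : Prop :=
  [/\ M `<=` circle, infinite_set M, M `<=` isolated M,
      finite_set (limit_point M)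
    & forall z, limit_point M z -> two_sided M z].

(* The boundary of S' is described by pairs (p, t), with p on the circle:
   t runs through [0, 1] when p is an accumulation point z of M, so that
   (z, 0) = z^-, (z, 1) = z^+, and t = 0 for the other points p.
   The cyclic order is the lexicographic refinement of that of the circle. *)
Local Notation pt' := (pt * R)%type.

Definition before (a b : pt') : Prop := a.1 = b.1 /\ a.2 < b.2.

Definition ccw' (a b c : pt') : Prop :=
  [\/ ccw a.1 b.1 c.1,
      before a b /\ (before b c \/ c.1 <> a.1),
      before b c /\ (before c a \/ a.1 <> b.1)
    | before c a /\ (before a b \/ b.1 <> c.1)].

(* [zeta z j] is the position in (z^-, z^+) = (0, 1) of the added point z_j. *)
Definition added_points (M : set pt) (zeta : pt -> int -> R) : Prop :=
  forall z, limit_point M z ->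
    [/\ forall j, 0 < zeta z j < 1,
        {homo zeta z : i j / i < j},
        zeta z (Posz n) @[n --> \oo] --> (1 : R)
      & zeta z (- Posz n) @[n --> \oo] --> (0 : R)].

Definition marking' (M : set pt) (zeta : pt -> int -> R) : set pt' :=
  [set (m, 0) | m in M] `|`
  [set q | exists z j, limit_point M z /\ q = (z, zeta z j)].

Definition in_added_interval (M : set pt) (l : set pt') : Prop :=
  exists2 z, limit_point M z &
    forall q, l q -> q.1 = z /\ 0 < q.2 < 1.

End Disk.

(** * Categories and localization *)

Record category := Category {
  obj :> Type;
  Hom : obj -> obj -> Type;
  idm : forall X, Hom X X;
  compm : forall X Y Z, Hom Y Z -> Hom X Y -> Hom X Z;
  comp1m : forall X Y (f : Hom X Y), compm (idm Y) f = f;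
  compm1 : forall X Y (f : Hom X Y), compm f (idm X) = f;
  compA : forall X Y Z W (h : Hom Z W) (g : Hom Y Z) (f : Hom X Y),
    compm h (compm g f) = compm (compm h g) f }.

Arguments idm {c} X.
Arguments compm {c X Y Z} g f : rename.
Notation "g \com f" := (compm g f) (at level 40, left associativity).

Definition is_iso (C : category) (X Y : C) (f : Hom X Y) : Prop :=
  exists g : Hom Y X, g \com f = idm X /\ f \com g = idm Y.

Definition isomorphic (C : category) (X Y : C) : Prop :=
  exists f : Hom X Y, is_iso f.

Record functor (C D : category) := Functor {
  fobj :> C -> D;
  fmap : forall X Y, Hom X Y -> Hom (fobj X) (fobj Y);
  fmap1 : forall X, fmap (idm X) = idm (fobj X);
  fmapM : forall X Y Z (g : Hom Y Z) (f : Hom X Y),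
    fmap (g \com f) = fmap g \com fmap f }.

Arguments fmap {C D} F {X Y} f : rename.

Definition fcomp (C D E : category) (G : functor D E) (F : functor C D) :
  functor C E.
Proof.
apply: (@Functor _ _ (fun X => G (F X)) (fun X Y f => fmap G (fmap F f))).
- by move=> X; rewrite !fmap1.
- by move=> X Y Z g f; rewrite !fmapM.
Defined.

Definition is_natural (C D : category) (F G : functor C D)
    (eta : forall X, Hom (F X) (G X)) : Prop :=
  forall X Y (f : Hom X Y), fmap G f \com eta X = eta Y \com fmap F f.

Definition morphism_class (C : category) :=
  forall X Y : C, Hom X Y -> Prop.

Definition inverts (C D : category) (F : functor C D)
    (W : morphism_class C) : Prop :=
  forall X Y (f : Hom X Y), W X Y f -> is_iso (fmap F f).

(* Q : C -> D exhibits D as C[W^-1]: for every category E, composition with Q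
   is an equivalence from the functors D -> E onto the functors C -> E which
   invert W. *)
Definition is_localization (C D : category) (Q : functor C D)
    (W : morphism_class C) : Prop :=
  inverts Q W /\
  forall E : category,
    (forall F : functor C E, inverts F W ->
       exists (G : functor D E) (eta : forall X, Hom (fcomp G Q X) (F X)),
         is_natural eta /\ forall X, is_iso (eta X)) /\
    (forall (G G' : functor D E)
       (eta : forall X, Hom (fcomp G Q X) (fcomp G' Q X)), is_natural eta ->
       exists theta : forall Y, Hom (G Y) (G' Y),
         [/\ is_natural theta, forall X, theta (Q X) = eta X
           & forall theta' : forall Y, Hom (G Y) (G' Y),
               is_natural theta' -> (forall X, theta' (Q X) = eta X) ->
               forall Y, theta' Y = theta Y]).

(** * k-linear categories *)

Record lincat (k : fieldType) := LinCat {
  lobj :> Type;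
  lhom : lobj -> lobj -> lmodType k;
  lid : forall X, lhom X X;
  lcomp : forall X Y Z, lhom Y Z -> lhom X Y -> lhom X Z;
  lcomp1m : forall X Y (f : lhom X Y), lcomp (lid Y) f = f;
  lcompm1 : forall X Y (f : lhom X Y), lcomp f (lid X) = f;
  lcompA : forall X Y Z W (h : lhom Z W) (g : lhom Y Z) (f : lhom X Y),
    lcomp h (lcomp g f) = lcomp (lcomp h g) f;
  lcomp_linear_l : forall X Y Z (f : lhom X Y) (a : k) (g g' : lhom Y Z),
    lcomp (a *: g + g') f = a *: lcomp g f + lcomp g' f;
  lcomp_linear_r : forall X Y Z (g : lhom Y Z) (a : k) (f f' : lhom X Y),
    lcomp g (a *: f + f') = a *: lcomp g f + lcomp g f' }.

Arguments lid {k l} X.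
Arguments lcomp {k l X Y Z} g f : rename.
Notation "g \lcom f" := (lcomp g f) (at level 40, left associativity).

Coercion cat_of (k : fieldType) (C : lincat k) : category :=
  @Category (lobj C) (@lhom k C) (@lid k C) (@lcomp k C)
    (@lcomp1m k C) (@lcompm1 k C) (@lcompA k C).

(* The image of a morphism of a k-linear category, as a vector of [lhom]. *)
Definition lmap (k : fieldType) (C D : lincat k) (F : functor C D)
  (X Y : C) (f : lhom X Y) : lhom (F X : D) (F Y : D) := fmap F f.
Arguments lmap {k C D} F {X Y} f.

Definition is_linear (k : fieldType) (C D : lincat k) (F : functor C D) : Prop :=
  forall (X Y : C) (a : k) (f g : lhom X Y),
    lmap F (a *: f + g) = a *: lmap F f + lmap F g.

Section LinCat.
Variables (k : fieldType) (C : lincat k).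

Definition is_zero (X : C) : Prop := lid X = 0.

(* S is the direct sum (biproduct) of the finite family X. *)
Definition is_dsum (I : finType) (X : I -> C) (S : C) : Prop :=
  exists (inj : forall i, lhom (X i) S) (proj : forall i, lhom S (X i)),
    [/\ forall i, proj i \lcom inj i = lid (X i),
        forall i j, i != j -> proj j \lcom inj i = 0
      & \sum_i (inj i \lcom proj i) = lid S].

Definition is_dsum2 (A B S : C) : Prop :=
  is_dsum (fun b : bool => if b then A else B) S.

Definition is_additive : Prop :=
  forall (I : finType) (X : I -> C), exists S, is_dsum X S.

Definition indecomposable (X : C) : Prop :=
  ~ is_zero X /\ forall A B, is_dsum2 A B X -> is_zero A \/ is_zero B.

(* ell induces a bijection from the isomorphism classes of indecomposable
   objects onto L. *)
Definition indec_bij (L : Type) (B : set L) (ell : C -> L) : Prop :=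
  [/\ forall X, indecomposable X -> B (ell X),
      forall X Y, indecomposable X -> indecomposable Y ->
        (ell X = ell Y <-> isomorphic (X : cat_of C) Y)
    & forall l, B l -> exists2 X, indecomposable X & ell X = l].

Definition hom_finite : Prop :=
  forall X Y : C, exists (n : nat) (e : 'I_n -> lhom X Y),
    forall f, exists c : 'I_n -> k, f = \sum_i c i *: e i.

Definition local_end (X : C) : Prop :=
  ~ is_zero X /\
  forall f g : lhom X X, ~ is_iso (f : @Hom C X X) -> ~ is_iso (g : @Hom C X X) ->
    ~ is_iso (f + g : @Hom C X X).

Definition krull_schmidt : Prop :=
  forall X : C, exists (n : nat) (Y : 'I_n -> C),
    (forall i, local_end (Y i)) /\ is_dsum Y X.

Definition hom_is_k (X Y : C) : Prop :=
  exists phi : {linear lhom X Y -> k^o}, bijective phi.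

Definition hom_is_0 (X Y : C) : Prop := forall f : lhom X Y, f = 0.

End LinCat.

(** * Triangulated categories *)

Record triangulated (k : fieldType) := Triangulated {
  tcat :> lincat k;
  tadditive : is_additive tcat;
  suspension : functor tcat tcat;
  shift_linear : is_linear suspension;
  shift_ff : forall X Y : tcat, bijective (lmap suspension : lhom X Y -> _);
  shift_surj : forall Y : tcat, exists X : tcat,
    isomorphic (suspension X : cat_of tcat) Y;
  dist : forall X Y Z : tcat,
    lhom X Y -> lhom Y Z -> lhom Z (suspension X : tcat) -> Prop;
  dist_iso : forall (X Y Z X' Y' Z' : tcat)
      (f : lhom X Y) (g : lhom Y Z) (h : lhom Z (suspension X : tcat))
      (f' : lhom X' Y') (g' : lhom Y' Z') (h' : lhom Z' (suspension X' : tcat))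
      (u : lhom X X') (v : lhom Y Y') (w : lhom Z Z'),
    is_iso (u : @Hom tcat X X') -> is_iso (v : @Hom tcat Y Y') ->
    is_iso (w : @Hom tcat Z Z') ->
    v \lcom f = f' \lcom u -> w \lcom g = g' \lcom v ->
    lmap suspension u \lcom h = h' \lcom w ->
    dist f g h -> dist f' g' h';
  dist_id : forall X Z : tcat, is_zero Z ->
    dist (lid X) (0 : lhom X Z) (0 : lhom Z (suspension X : tcat));
  dist_cone : forall (X Y : tcat) (f : lhom X Y),
    exists (Z : tcat) (g : lhom Y Z) (h : lhom Z (suspension X : tcat)), dist f g h;
  dist_rotate : forall (X Y Z : tcat)
      (f : lhom X Y) (g : lhom Y Z) (h : lhom Z (suspension X : tcat)),
    dist f g h <-> dist g h (- lmap suspension f);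
  dist_fill : forall (X Y Z X' Y' Z' : tcat)
      (f : lhom X Y) (g : lhom Y Z) (h : lhom Z (suspension X : tcat))
      (f' : lhom X' Y') (g' : lhom Y' Z') (h' : lhom Z' (suspension X' : tcat))
      (u : lhom X X') (v : lhom Y Y'),
    dist f g h -> dist f' g' h' -> v \lcom f = f' \lcom u ->
    exists w : lhom Z Z',
      w \lcom g = g' \lcom v /\ lmap suspension u \lcom h = h' \lcom w;
  dist_octahedron : forall (X Y Z X' Y' Z' : tcat)
      (f : lhom X Y) (f1 : lhom Y Z') (f2 : lhom Z' (suspension X : tcat))
      (g : lhom Y Z) (g1 : lhom Z X') (g2 : lhom X' (suspension Y : tcat))
      (h1 : lhom Z Y') (h2 : lhom Y' (suspension X : tcat)),
    dist f f1 f2 -> dist g g1 g2 -> dist (g \lcom f) h1 h2 ->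
    exists (u : lhom Z' Y') (v : lhom Y' X'),
      dist u v (lmap suspension f1 \lcom g2) /\
      [/\ u \lcom f1 = h1 \lcom g, h2 \lcom u = f2,
          v \lcom h1 = g1 & g2 \lcom v = lmap suspension f \lcom h2] }.

Arguments suspension {k} t.
Arguments dist {k t X Y Z} f g h : rename.

Section Triangulated.
Variables (k : fieldType) (C : triangulated k).

Definition susp (X : C) : C := suspension C X.

(* Isomorphisms Hom(X, Y) = Hom(Y, X[2])^*, natural in X and Y, given by the
   corresponding bilinear pairings. *)
Definition two_CY : Prop :=
  exists pair : forall X Y : C, lhom X Y -> lhom Y (susp (susp X)) -> k,
    [/\ forall X Y (g : lhom Y (susp (susp X))) (a : k) (f f' : lhom X Y),
          pair X Y (a *: f + f') g = a * pair X Y f g + pair X Y f' g,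
        forall X Y (f : lhom X Y) (a : k) (g g' : lhom Y (susp (susp X))),
          pair X Y f (a *: g + g') = a * pair X Y f g + pair X Y f g',
        forall X Y (phi : {linear lhom Y (susp (susp X)) -> k^o}),
          exists! f : lhom X Y, forall g, pair X Y f g = phi g
      & forall X X' Y Y' (u : lhom X' X) (f : lhom X Y) (v : lhom Y Y')
            (g : lhom Y' (susp (susp X'))),
          pair X' Y' (v \lcom f \lcom u) g =
          pair X Y f (lmap (suspension C) (lmap (suspension C) u) \lcom g \lcom v)].

(* A distinguished triangle is split exactly when its last map vanishes. *)
Definition nonsplit_triangle (X Y Z : C) : Prop :=
  exists (f : lhom X Y) (g : lhom Y Z) (h : lhom Z (susp X)),
    dist f g h /\ h <> 0.

Definition cone_in (D : C -> Prop) : morphism_class C :=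
  fun X Y (f : lhom X Y) =>
    exists (Z : C) (g : lhom Y Z) (h : lhom Z (susp X)), dist f g h /\ D Z.

End Triangulated.

(** * Discrete cluster categories of type A *)

Section ClusterCategory.
Variables (k : fieldType) (C : triangulated k).
Variables (T : Type) (cyc : T -> T -> T -> Prop) (A : set T).

(* [ell X] is the arc of X; it is meaningful for indecomposable X only. *)
Variable ell : C -> set T.

(* X is the object attached to the pair {a, b}: boundary segments are
   identified with zero. *)
Definition represents (a b : T) (X : C) : Prop :=
  (neighbours cyc A a b -> is_zero X) /\
  (~ neighbours cyc A a b -> indecomposable X /\ ell X = [set a; b]).

Record is_discrete_cluster_category : Prop := {
  dcc_hom_finite : hom_finite C;
  dcc_krull_schmidt : krull_schmidt C;
  dcc_two_CY : two_CY C;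
  dcc_arcs : indec_bij (arcs cyc A A) ell;
  (* a' = sigma(a) is the next point of A after a in clockwise direction. *)
  dcc_susp : forall (X : C) (a b a' b' : T),
    indecomposable X -> ell X = [set a; b] ->
    next_ccw cyc A a' a -> next_ccw cyc A b' b ->
    ell (susp X) = [set a'; b'];
  dcc_hom_crossing : forall X Y : C, indecomposable X -> indecomposable Y ->
    crosses cyc (ell X) (ell Y) -> hom_is_k X (susp Y);
  dcc_hom_noncrossing : forall X Y : C, indecomposable X -> indecomposable Y ->
    ~ crosses cyc (ell X) (ell Y) -> hom_is_0 X (susp Y);
  dcc_triangles : forall (a1 a2 a3 a4 : T) (X Y XA XB XC XD : C),
    A a1 -> A a2 -> A a3 -> A a4 -> cyc4 cyc a1 a2 a3 a4 ->
    represents a1 a3 X -> represents a2 a4 Y ->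
    represents a1 a2 XA -> represents a2 a3 XB ->
    represents a3 a4 XC -> represents a4 a1 XD ->
    exists BD AC : C,
      [/\ is_dsum2 XB XD BD, is_dsum2 XA XC AC,
          nonsplit_triangle X BD Y & nonsplit_triangle Y AC X] }.

End ClusterCategory.

(* The additive subcategory D generated by the indecomposables whose arc has
   both endpoints in the same added interval. *)
Definition added_subcategory (R : realType) (k : fieldType)
    (C : triangulated k) (M : set (R * R))
    (ell : C -> set (R * R * R)) (X : C) : Prop :=
  exists (n : nat) (Y : 'I_n -> C),
    (forall i, indecomposable (Y i) /\ in_added_interval M (ell (Y i))) /\
    is_dsum Y X.

(* Main.v *)
Require Import Defs.
From mathcomp Require Import all_boot all_order all_algebra.
From mathcomp Require Import all_classical all_reals all_analysis.
From mathcomp Require Import ring lra zify.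
Import Order.TTheory GRing.Theory Num.Theory numFieldNormedType.Exports.
Set Implicit Arguments.
Unset Strict Implicit.
Unset Printing Implicit Defensive.
Local Open Scope classical_set_scope.
Local Open Scope ring_scope.

(** The quotient is studied through the functors Hom(P, -[1]), for P an
    arc of the refined disk with both ends in M.

    Such an arc crosses no arc inside an added interval, and its suspension is
    of the same kind, so Hom(P, Z) = Hom(P, Z[1]) = 0 for Z in the thick
    subcategory D, using 2-Calabi-Yau duality for the first equality
    (marked_arc_perp). By the long exact sequence, Hom(P, -[1]) inverts the maps
    with cone in D. It therefore factors through the localization: Hom(P, X[1])
    depends, up to linear isomorphism, only on the image Q X (quotient_hom). It is
    k or 0 according to whether P crosses X, and P crosses X exactly
    when it crosses the arc obtained from X by collapsing the added intervals
    (crossesP). On the other hand an arc of the closure of M is determined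
    by the arcs of M which cross it: given another arc, an end a of the first
    one which is not an end of the second is cut off from the other ends by an
    arc of M close to a, which crosses the first arc only (separating_arc).

    This gives everything about the images of the indecomposables X.
    - If X projects to a single point, X is in D and Q X = 0 (quotient_zero).
    - Otherwise Q X is nonzero, as some P crosses X (quotient_nonzero), and
      indecomposable, as the one-dimensional space Hom(P, X[1]) has no room for
      two summands crossed by the same P (quotient_indecomposable).
    - Isomorphic images have the same crossings, hence the same projection.
      Conversely an end can be moved inside an added interval along a
      triangle with cone in D (quotient_iso_added), so equal projections give
      isomorphic images (quotient_iso_ends).

    Finally every object of the quotient is isomorphic to some Q X
    (localization_ess_surj) and X is a finite sum of indecomposables, so every
    indecomposable of the quotient is the image of one (quotient_indec_lift).

    On the geometric side, the circle minus a point a is parametrized by the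
    cotangent of half the angle from a. This turns the cyclic order into the order
    of the reals, and the existence of the neighbours of a marked point into the
    existence of a supremum (next_marked). *)

(** * The cyclic order of the circle *)

Section CircleOrder.
Variable R : realType.
Local Notation pt := (R * R)%type.
Implicit Types (a b c d x y z p q : pt) (s : R).

(** The relation ccw a b c unfolds to 0 < area a b c. *)
Definition area a b c : R :=
  (b.1 - a.1) * (c.2 - a.2) - (b.2 - a.2) * (c.1 - a.1).

(** In coordinates where a is (1, 0), the numbers dotp a b and det a b are the
    cosine and the sine of the angle from a to b. *)
Definition dotp a b : R := a.1 * b.1 + a.2 * b.2.
Definition det a b : R := a.1 * b.2 - a.2 * b.1.

(** The cotangent of half the angle from a to b: a decreasing parameter
    along the circle minus a, in which the cyclic order becomes the order of R. *)
Definition cot_half a b : R := det a b / (1 - dotp a b).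

Definition at_cot_half a (t : R) : pt :=
  let u := (t ^+ 2 - 1) / (t ^+ 2 + 1) in
  let v := (2 * t) / (t ^+ 2 + 1) in
  (a.1 * u - a.2 * v, a.2 * u + a.1 * v).

Lemma area_rot a b c : area a b c = area b c a.
Proof. by rewrite /area; ring. Qed.

Lemma area_swap a b c : area a c b = - area a b c.
Proof. by rewrite /area; ring. Qed.

Lemma area_xx a b : area a a b = 0.
Proof. by rewrite /area; ring. Qed.

Lemma area_xyx a b : area a b a = 0.
Proof. by rewrite /area; ring. Qed.

Lemma area_xyy a b : area a b b = 0.
Proof. by rewrite /area; ring. Qed.

Lemma dotp_det a b : circle a -> circle b -> dotp a b ^+ 2 + det a b ^+ 2 = 1.
Proof.
rewrite /circle /dotp /det /= => ha hb.
transitivity ((a.1 ^+ 2 + a.2 ^+ 2) * (b.1 ^+ 2 + b.2 ^+ 2)); first by ring.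
by rewrite ha hb mulr1.
Qed.

Lemma chord_sqr a b : circle a -> circle b ->
  2 * (1 - dotp a b) = (a.1 - b.1) ^+ 2 + (a.2 - b.2) ^+ 2.
Proof. by rewrite /circle /dotp /= => ha hb; lra. Qed.

Lemma dotp_lt1 a b : circle a -> circle b -> a <> b -> 0 < 1 - dotp a b.
Proof.
move=> ha hb hab; have e := chord_sqr ha hb.
rewrite -(pmulr_rgt0 _ (ltr0Sn R 1)) e lt0r addr_ge0 ?sqr_ge0// andbT.
apply/eqP => /eqP; rewrite paddr_eq0 ?sqr_ge0// !sqrf_eq0 !subr_eq0.
case/andP => /eqP e1 /eqP e2; apply: hab.
by case: a b e1 e2 {ha hb e} => [? ?] [? ?] /= -> ->.
Qed.

Lemma area_dotp_det a b c : circle a ->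
  area a b c = det a b * (1 - dotp a c) - det a c * (1 - dotp a b).
Proof.
rewrite /circle /area /dotp /det /= => ha.
have {1}-> : (b.1 - a.1) * (c.2 - a.2) - (b.2 - a.2) * (c.1 - a.1) =
  (a.1 ^+ 2 + a.2 ^+ 2) * (b.1 * c.2 - b.2 * c.1) - (a.1 * c.2 - a.2 * c.1)
  + (a.1 * b.2 - a.2 * b.1) by rewrite ha; ring.
ring.
Qed.

Lemma area_cot_half a b c : circle a -> circle b -> circle c ->
  a <> b -> a <> c ->
  area a b c =
  (1 - dotp a b) * (1 - dotp a c) * (cot_half a b - cot_half a c).
Proof.
move=> ha hb hc hab hac; rewrite area_dotp_det// /cot_half.
have := dotp_lt1 ha hb hab; have := dotp_lt1 ha hc hac.
by move=> /lt0r_neq0 h1 /lt0r_neq0 h2; field; apply/andP.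
Qed.

(** The sign s = 1 or s = -1 lets one argument serve both directions of
    travel: s * area a b c is positive when a, b, c are met in this order
    in the direction given by s. *)
Lemma sg_area_cot_half s a b c : circle a -> circle b -> circle c ->
  a <> b -> a <> c ->
  (0 < s * area a b c) = (s * cot_half a c < s * cot_half a b).
Proof.
move=> ha hb hc hab hac; rewrite area_cot_half// mulrCA pmulr_rgt0.
  by rewrite mulrBr subr_gt0.
by rewrite mulr_gt0 ?dotp_lt1.
Qed.

Lemma cot_halfK a b : circle a -> circle b -> a <> b ->
  at_cot_half a (cot_half a b) = b.
Proof.
move=> ha hb hab; have h0 := dotp_lt1 ha hb hab.
have h1 := dotp_det ha hb.
have h2 : 1 - dotp a b != 0 by rewrite gt_eqF.
have v2 : det a b ^+ 2 = (1 - dotp a b) * (1 + dotp a b).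
  by move: h1; rewrite -subr_sqr expr1n; lra.
have t2 : cot_half a b ^+ 2 = (1 + dotp a b) / (1 - dotp a b).
  by rewrite /cot_half expr_div_n v2; field.
have t21 : cot_half a b ^+ 2 + 1 = 2 / (1 - dotp a b).
  by rewrite t2; field.
have -> : at_cot_half a (cot_half a b) =
    (a.1 * dotp a b - a.2 * det a b, a.2 * dotp a b + a.1 * det a b).
  rewrite /at_cot_half t21 t2 /cot_half.
  have -> : ((1 + dotp a b) / (1 - dotp a b) - 1) / (2 / (1 - dotp a b)) = dotp a b.
    by field.
  have -> // : 2 * (det a b / (1 - dotp a b)) / (2 / (1 - dotp a b)) = det a b.
  by field.
case: b {hb hab h0 h1 h2 v2 t2 t21} => b1 b2.
move: ha; rewrite /circle /dotp /det /= => ha; congr pair.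
  by transitivity ((a.1 ^+ 2 + a.2 ^+ 2) * b1); [ring | rewrite ha mul1r].
by transitivity ((a.1 ^+ 2 + a.2 ^+ 2) * b2); [ring | rewrite ha mul1r].
Qed.

Let sqr1_neq0 (t : R) : t ^+ 2 + 1 != 0.
Proof. by rewrite gt_eqF// ltr_wpDl ?sqr_ge0. Qed.

Lemma at_cot_half_circle a t : circle a -> circle (at_cot_half a t).
Proof.
rewrite /circle /= => ha; have h := sqr1_neq0 t.
set u := (t ^+ 2 - 1) / _; set v := (2 * t) / _.
have huv : u ^+ 2 + v ^+ 2 = 1 by rewrite /u /v; field.
transitivity ((a.1 ^+ 2 + a.2 ^+ 2) * (u ^+ 2 + v ^+ 2)); first by ring.
by rewrite ha huv mulr1.
Qed.

Lemma dotp_at_cot_half a t : circle a ->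
  1 - dotp a (at_cot_half a t) = 2 / (t ^+ 2 + 1).
Proof.
rewrite /circle /dotp /= => ha; have h := sqr1_neq0 t.
set u := (t ^+ 2 - 1) / _; set v := (2 * t) / _.
transitivity (1 - (a.1 ^+ 2 + a.2 ^+ 2) * u); first by ring.
by rewrite ha /u; field.
Qed.

Lemma at_cot_half_neq a t : circle a -> a <> at_cot_half a t.
Proof.
move=> ha e; have := dotp_at_cot_half t ha; rewrite -e.
have -> : dotp a a = 1 by move: ha; rewrite /circle /dotp /= => <-; ring.
move/eqP; rewrite subrr eq_sym; apply/negP.
by rewrite mulf_neq0 ?invr_eq0 ?sqr1_neq0 ?pnatr_eq0.
Qed.

Lemma at_cot_halfK a t : circle a -> cot_half a (at_cot_half a t) = t.
Proof.
move=> ha; rewrite /cot_half dotp_at_cot_half//; have h := sqr1_neq0 t.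
have -> : det a (at_cot_half a t) = 2 * t / (t ^+ 2 + 1).
  move: ha; rewrite /circle /det /= => ha.
  set u := (t ^+ 2 - 1) / _; set v := (2 * t) / _.
  by transitivity ((a.1 ^+ 2 + a.2 ^+ 2) * v); [ring | rewrite ha mul1r].
by field.
Qed.

Lemma area_neq0 a b c : circle a -> circle b -> circle c ->
  a <> b -> b <> c -> a <> c -> area a b c != 0.
Proof.
move=> ha hb hc hab hbc hac; rewrite area_cot_half//.
apply: mulf_neq0; first by rewrite mulf_neq0 ?gt_eqF ?dotp_lt1.
rewrite subr_eq0; apply/eqP => e; apply: hbc.
by rewrite -(cot_halfK ha hb hab) e cot_halfK.
Qed.

Lemma sg_area_neq s a b c : 0 < s * area a b c -> [/\ a <> b, b <> c & a <> c].
Proof.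
move=> h; split => e; move: h; rewrite e ?area_xx ?area_xyy ?area_xyx mulr0 ltxx//.
Qed.

Lemma sg_area_total s a b c : s != 0 -> circle a -> circle b -> circle c ->
  a <> b -> b <> c -> a <> c -> 0 < s * area a b c \/ 0 < s * area a c b.
Proof.
move=> s0 ha hb hc hab hbc hac; have := area_neq0 ha hb hc hab hbc hac.
rewrite [area a c b]area_swap mulrN oppr_gt0 => h.
by apply/orP; rewrite -neq_lt eq_sym mulf_neq0.
Qed.

Lemma sg_area_trans s a b c d : circle a -> circle b -> circle c -> circle d ->
  0 < s * area a b c -> 0 < s * area a c d -> 0 < s * area a b d.
Proof.
move=> ha hb hc hd h1 h2; have [n1 _ n2] := sg_area_neq h1.
have [_ _ n3] := sg_area_neq h2.
by move: h1 h2; rewrite !sg_area_cot_half// => h1 h2; apply: lt_trans h1.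
Qed.

Lemma ccw_rot a b c : ccw a b c -> ccw b c a.
Proof. by rewrite /ccw -!/(area _ _ _) area_rot. Qed.

Lemma ccw_asym a b c : ccw a b c -> ~ ccw a c b.
Proof.
rewrite /ccw -!/(area _ _ _) [area a c b]area_swap oppr_gt0 => h h'.
by have := lt_trans h h'; rewrite ltxx.
Qed.

Lemma ccw_neq a b c : ccw a b c -> [/\ a <> b, b <> c & a <> c].
Proof. by move=> h; apply: (@sg_area_neq 1); rewrite mul1r. Qed.

Lemma ccw_trans a b c d : circle a -> circle b -> circle c -> circle d ->
  ccw a b c -> ccw a c d -> ccw a b d.
Proof.
move=> ha hb hc hd; rewrite /ccw -!/(area _ _ _) => h1 h2.
by have := @sg_area_trans 1 _ _ _ _ ha hb hc hd; rewrite !mul1r; apply.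
Qed.

(** * Continuity *)

Let fst_continuous : continuous (fst : pt -> R).
Proof. by move=> x; exact: cvg_fst. Qed.

Let snd_continuous : continuous (snd : pt -> R).
Proof. by move=> x; exact: cvg_snd. Qed.

Lemma area_continuous a b : continuous (area a b).
Proof.
move=> x; rewrite /area; apply: cvgB.
  apply: cvgM; first exact: cvg_cst.
  by apply: cvgB; [exact: snd_continuous | exact: cvg_cst].
apply: cvgM; first exact: cvg_cst.
by apply: cvgB; [exact: fst_continuous | exact: cvg_cst].
Qed.

Lemma dotp_continuous a : continuous (dotp a).
Proof.
move=> x; rewrite /dotp; apply: cvgD.
  by apply: cvgM; [exact: cvg_cst | exact: fst_continuous].
by apply: cvgM; [exact: cvg_cst | exact: snd_continuous].
Qed.

Lemma det_continuous a : continuous (det a).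
Proof.
move=> x; rewrite /det; apply: cvgB.
  by apply: cvgM; [exact: cvg_cst | exact: snd_continuous].
by apply: cvgM; [exact: cvg_cst | exact: fst_continuous].
Qed.

Lemma near_gt0 (T : topologicalType) (f : T -> R) (x : T) :
  {for x, continuous f} -> 0 < f x -> \forall y \near x, 0 < f y.
Proof. by move=> cf f0; exact: (cvgr_gt _ cf). Qed.

Lemma near_area s a b x : 0 < s * area a b x ->
  \forall y \near x, 0 < s * area a b y.
Proof.
apply: (@near_gt0 _ (fun y => s * area a b y)).
by apply: cvgM; [exact: cvg_cst | exact: area_continuous].
Qed.

Lemma at_cot_half_continuous a : continuous (at_cot_half a).
Proof.
move=> t.
have c2 : {for t, continuous (fun t : R => t ^+ 2)}.
  rewrite /prop_for /continuous_at; under eq_fun do rewrite expr2.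
  by apply: cvgM; exact: cvg_id.
have ci : {for t, continuous (fun t : R => (t ^+ 2 + 1)^-1)}.
  apply: cvgV; first exact: sqr1_neq0.
  by apply: cvgD => //; exact: cvg_cst.
have cu : {for t, continuous (fun t : R => (t ^+ 2 - 1) / (t ^+ 2 + 1))}.
  by apply: cvgM => //; apply: cvgB => //; exact: cvg_cst.
have cv : {for t, continuous (fun t : R => (2 * t) / (t ^+ 2 + 1))}.
  by apply: cvgM => //; apply: cvgM; [exact: cvg_cst | exact: cvg_id].
have h1 : {for t, continuous (fun t : R => a.1 * ((t ^+ 2 - 1) / (t ^+ 2 + 1)) -
    a.2 * ((2 * t) / (t ^+ 2 + 1)))}.
  by apply: cvgB; (apply: cvgM; first exact: cvg_cst).
have h2 : {for t, continuous (fun t : R => a.2 * ((t ^+ 2 - 1) / (t ^+ 2 + 1)) +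
    a.1 * ((2 * t) / (t ^+ 2 + 1)))}.
  by apply: cvgD; (apply: cvgM; first exact: cvg_cst).
exact: (cvg_pair h1 h2).
Qed.

(** On the circle, (1 + dotp a q) * area a q y is the product of det a q and of
    an expression which tends to 2 * (1 - dotp a y) > 0 as q tends to a. So,
    for q close to a, the order of a, q, y only depends on the side of a
    on which q lies. *)
Lemma near_side a y : circle a -> circle y -> a <> y ->
  \forall q \near a, circle q ->
    forall s, 0 < s * det a q -> 0 < s * area a q y.
Proof.
move=> ha hy hay.
have daa : dotp a a = 1 by move: ha; rewrite /circle /dotp /= => <-; ring.
have vaa : det a a = 0 by rewrite /det; ring.
have h1 : \forall q \near a,
    0 < (1 - dotp a y) * (1 + dotp a q) - det a y * det a q.
  apply: near_gt0; last first.
    by rewrite daa vaa mulr0 subr0 pmulr_lgt0 ?dotp_lt1.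
  apply: cvgB.
    apply: cvgM; first exact: cvg_cst.
    by apply: cvgD; [exact: cvg_cst | exact: dotp_continuous].
  by apply: cvgM; [exact: cvg_cst | exact: det_continuous].
have h2 : \forall q \near a, 0 < 1 + dotp a q.
  apply: near_gt0; last by rewrite daa.
  by apply: cvgD; [exact: cvg_cst | exact: dotp_continuous].
apply: filterS2 h1 h2 => q h1 h2 hq s hs.
rewrite -(pmulr_rgt0 _ h2).
have -> : (1 + dotp a q) * (s * area a q y) = (s * det a q) *
    ((1 - dotp a y) * (1 + dotp a q) - det a y * det a q).
  have e : (1 - dotp a q) * (1 + dotp a q) = det a q ^+ 2.
    by have := dotp_det ha hq; rewrite -subr_sqr expr1n; lra.
  rewrite area_dotp_det//.
  transitivity (s * (det a q * (1 - dotp a y) * (1 + dotp a q)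
    - det a y * ((1 - dotp a q) * (1 + dotp a q)))); first by ring.
  by rewrite e; ring.
by rewrite mulr_gt0.
Qed.

Lemma circle_closed : closed (@circle R).
Proof.
have -> : @circle R = (fun p : pt => dotp p p) @^-1` [set 1].
  by apply/seteqP; split => p; rewrite /circle /dotp /= !expr2.
apply: preimage_closed; last exact: closed_eq.
move=> x _; rewrite /dotp; apply: cvgD; apply: cvgM;
  by [exact: fst_continuous | exact: snd_continuous].
Qed.

End CircleOrder.

(** * Marked points *)

Section Marking.
Variable R : realType.
Local Notation pt := (R * R)%type.
Variable M : set pt.
Hypothesis hM : admissible_marking M.
Implicit Types (a b c x y z p q : pt) (s : R).

Local Notation Mbar := (M `|` limit_point M).

Lemma limit_not_marked z : limit_point M z -> ~ M z.
Proof.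
case: hM => _ _ iM _ _ lz Mz; have [_ [V Vz VM]] := iM _ Mz.
have [y [/eqP yz My Vy]] := lz _ Vz.
by apply: yz; have : [set z] y by rewrite -VM.
Qed.

Lemma near_marked x (P : pt -> Prop) : Mbar x -> (\forall y \near x, P y) ->
  exists2 m, M m & P m.
Proof.
case=> [Mx|lx] Px; first by exists x => //; exact: nbhs_singleton Px.
by have [y [_ My Py]] := lx _ Px; exists y.
Qed.

Lemma closure_circle x : Mbar x -> circle x.
Proof.
case: hM => Mc _ _ _ _ hx; apply: circle_closed => B Bx.
by have [m Mm Bm] := near_marked hx Bx; exists m; split => //; exact: Mc.
Qed.

Lemma near_marked_side s z (P : pt -> Prop) : s = 1 \/ s = -1 ->
  limit_point M z -> (\forall y \near z, P y) ->
  exists q, [/\ M q, P q & 0 < s * det z q].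
Proof.
case: hM => _ _ _ _ tM hs lz Pz; have [[u [_ Mu du cu]] [v [_ Mv dv cv]]] := tM _ lz.
case: hs => ->.
  have [n _ Pn] := cu _ Pz; exists (u n); split => //; first exact: Pn (leqnn n).
  by rewrite mul1r; exact: du.
have [n _ Pn] := cv _ Pz; exists (v n); split => //; first exact: Pn (leqnn n).
by rewrite mulN1r oppr_gt0; exact: dv.
Qed.

Lemma sign_sqr s : s = 1 \/ s = -1 -> s * s = 1.
Proof. by case=> ->; rewrite ?mulr1// mulrNN mulr1. Qed.

Lemma sign_neq0 s : s = 1 \/ s = -1 -> s != 0.
Proof. by case=> ->; rewrite ?oppr_eq0 oner_neq0. Qed.

Lemma sign_opp s : s = 1 \/ s = -1 -> - s = 1 \/ - s = -1.
Proof. by case=> ->; [right | left; rewrite opprK]. Qed.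

Lemma cot_half_bounded a : M a ->
  exists B, forall s x, s = 1 \/ s = -1 -> M x -> a <> x -> s * cot_half a x <= B.
Proof.
case: hM => Mc _ iM _ _ Ma; have [_ [V Va VM]] := iM _ Ma.
have [e /= e0 eV] := (nbhs_ballP a V).1 Va.
exists (2 / e ^+ 2) => s x hs Mx ax.
have ca := Mc _ Ma; have cx := Mc _ Mx.
have h0 := dotp_lt1 ca cx ax.
have far : e ^+ 2 <= 2 * (1 - dotp a x).
  rewrite chord_sqr//; rewrite leNgt; apply/negP => hlt.
  apply: ax; suff : V x by move=> Vx; have : [set a] x by rewrite -VM.
  apply: eV; split => /=; rewrite /ball /=.
    rewrite -(ltr_pXn2r (ltn0Sn 1)) ?nnegrE ?(ltW e0)// real_normK ?num_real//.
    by apply: le_lt_trans hlt; rewrite lerDl sqr_ge0.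
  rewrite -(ltr_pXn2r (ltn0Sn 1)) ?nnegrE ?(ltW e0)// real_normK ?num_real//.
  by apply: le_lt_trans hlt; rewrite lerDr sqr_ge0.
have d1 : s * det a x <= 1.
  rewrite (le_trans (ler_norm _))// -(ler_pXn2r (ltn0Sn 1)) ?nnegrE//.
  rewrite real_normK ?num_real// exprMn [s ^+ 2]expr2 sign_sqr// mul1r expr1n.
  by rewrite -(dotp_det ca cx) lerDr sqr_ge0.
rewrite /cot_half mulrA ler_pdivrMr// mulrAC ler_pdivlMr ?exprn_gt0//.
apply: le_trans far; rewrite ler_piMl//; exact: sqr_ge0.
Qed.

Definition first_from s a q : Prop :=
  forall x, M x -> a <> x -> x <> q -> 0 < s * area a q x.

(** The supremum of the values of cot_half a, times s, over the other
    points of M is attained.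
    Otherwise the point y of the circle with this parameter would be an
    accumulation point of M, and since M also accumulates at y from the side
    of a, some point of M would lie strictly between a and y. *)
Lemma next_marked s a : s = 1 \/ s = -1 -> M a ->
  exists q, [/\ M q, a <> q & first_from s a q].
Proof.
move=> hs Ma; have [Mc iM _ _ _] := hM; have ca := Mc _ Ma.
pose T : set R := [set s * cot_half a x | x in M `\ a].
have T0 : T !=set0.
  have /infinite_setN0 [x [Mx xa]] : infinite_set (M `\ a).
    apply: contra_not iM => h; rewrite -(setD1K Ma) finite_setU; split => //.
  by exists (s * cot_half a x); exists x.
have ub : has_ubound T.
  have [B hB] := cot_half_bounded Ma; exists B => _ [x [Mx /= xa] <-].
  by apply: hB => // e; apply: xa.
have sT : has_sup T by split.
pose tau := sup T; pose y := at_cot_half a (s * tau).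
have cy : circle y by exact: at_cot_half_circle.
have ay : a <> y by exact: at_cot_half_neq.
have ty : s * cot_half a y = tau by rewrite at_cot_halfK// mulrA sign_sqr// mul1r.
have le_tau x : M x -> a <> x -> s * cot_half a x <= tau.
  by move=> Mx ax; apply: ub_le_sup => //; exists x => //; split => // e; apply: ax.
have [My|nMy] := pselect (M y).
  exists y; split => // x Mx ax xy; have cx := Mc _ Mx.
  rewrite sg_area_cot_half// ty lt_neqAle le_tau// andbT.
  apply/eqP => e; apply: xy; rewrite -(cot_halfK ca cx ax).
  by rewrite /y -e mulrA sign_sqr// mul1r.
have ly : limit_point M y.
  move=> U Uy; have := @at_cot_half_continuous _ a (s * tau) _ Uy.
  have cs : {for tau, continuous (fun t : R => s * t)}.
    by apply: cvgM; [exact: cvg_cst | exact: cvg_id].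
  move=> /cs /(nbhs_ballP _ _).1 [e /= e0 he].
  have [_ [x [Mx /= xa] <-] hx] := sup_adherent e0 sT.
  have ax : a <> x by move=> E; apply: xa.
  exists x; split => //; first by apply/eqP => E; apply: nMy; rewrite -E.
  have -> : x = at_cot_half a (s * (s * cot_half a x)).
    by rewrite mulrA sign_sqr// mul1r cot_halfK//; exact: Mc.
  apply: he; rewrite /ball /= ger0_norm ?subr_ge0 ?le_tau//.
  by move: hx; rewrite -/tau; lra.
(* points of M approach y from the side of a, where the parameter exceeds tau *)
have ya : y <> a by move=> E; apply: ay.
have [q [Mq hq dq]] := near_marked_side (sign_opp hs) ly (near_side cy ca ya).
have cq := Mc _ Mq.
have hyqa := hq cq _ dq.
have haqy : 0 < s * area a q y.
  by rewrite area_rot [area q y a]area_rot area_swap mulrN -mulNr.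
have [aq _ _] := sg_area_neq haqy.
move: haqy; rewrite sg_area_cot_half// ty => h.
by have := lt_le_trans h (le_tau _ Mq aq); rewrite ltxx.
Qed.

Lemma next_ccw_of_side a q : M a -> M q -> a <> q ->
  first_from 1 a q -> next_ccw (@ccw R) M a q.
Proof.
move=> Ma Mq aq n; split => // c Mc h; have [n1 n2 n3] := ccw_neq h.
by have := n c Mc n1 n2; rewrite mul1r; exact: ccw_asym.
Qed.

Lemma prev_ccw_of_side a p : M a -> M p -> a <> p ->
  first_from (-1) a p -> next_ccw (@ccw R) M p a.
Proof.
move=> Ma Mp ap n; split => // [e|c Mc /ccw_rot h]; first exact: ap.
have [n1 n2 n3] := ccw_neq h.
have := n c Mc (fun e => n1 (esym e)) n3; rewrite mulN1r -area_swap.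
by apply: ccw_asym; apply: ccw_rot.
Qed.

Lemma prev_marked a : M a -> exists p, next_ccw (@ccw R) M p a.
Proof.
move=> Ma; have [p [Mp ap n]] := next_marked (or_intror erefl) Ma.
by exists p; exact: prev_ccw_of_side.
Qed.

Lemma next_closure s a q : s = 1 \/ s = -1 -> M a -> M q -> a <> q ->
  first_from s a q -> forall x, Mbar x -> a <> x -> x <> q -> 0 < s * area a q x.
Proof.
move=> hs Ma Mq aq nq x [Mx|lx] ax xq; first exact: nq.
have ca : circle a by apply: closure_circle; left.
have cq : circle q by apply: closure_circle; left.
have cx : circle x by apply: closure_circle; right.
have qx : q <> x by move=> e; apply: xq.
have [//|h] := sg_area_total (sign_neq0 hs) ca cq cx aq qx ax.
have h' : 0 < s * area q a x by rewrite area_rot.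
have [m Mm hm] := near_marked (or_intror lx) (near_area h').
have [qa am qm] := sg_area_neq hm.
have mq : m <> q by move=> e; apply: qm.
have := nq m Mm am mq; move: hm; rewrite [area a q m]area_rot [area q m a]area_swap.
by rewrite mulrN oppr_gt0 => h1 h2; have := lt_trans h1 h2; rewrite ltxx.
Qed.

(** When a is an accumulation point, q is chosen near a; when a is marked,
    q is its neighbour, and then one of the points may coincide with q. *)
Lemma close_marked s a x1 x2 x3 : s = 1 \/ s = -1 -> Mbar a ->
  Mbar x1 -> Mbar x2 -> Mbar x3 -> a <> x1 -> a <> x2 -> a <> x3 ->
  exists q, [/\ M q, a <> q & forall x, x = x1 \/ x = x2 \/ x = x3 ->
    0 < s * area a q x \/ [/\ x = q, M a & first_from s a q]].
Proof.
move=> hs [Ma|la] h1 h2 h3 a1 a2 a3.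
  have [q [Mq aq nq]] := next_marked hs Ma; exists q; split => // x hx.
  have Mx : Mbar x by case: hx => [->|[->|->]].
  have ax : a <> x by case: hx => [->|[->|->]].
  have [->|xq] := pselect (x = q); first by right.
  by left; exact: next_closure.
have ca : circle a by apply: closure_circle; right.
have N1 := near_side ca (closure_circle h1) a1.
have N2 := near_side ca (closure_circle h2) a2.
have N3 := near_side ca (closure_circle h3) a3.
have [q [Mq [[n1 n2] n3] dq]] :=
  near_marked_side hs la (filterI (filterI N1 N2) N3).
have cq : circle q by apply: closure_circle; left.
exists q; split => //; first by have [] := sg_area_neq (n1 cq _ dq).
by move=> x [->|[->|->]]; left; [exact: n1 | exact: n2 | exact: n3].
Qed.

(** Being between x and z is an open condition, so an accumulation point in
    between comes with marked points in between. *)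
Lemma marked_between x y z : Mbar y -> ccw x y z -> exists2 m, M m & ccw x m z.
Proof.
move=> My /ccw_rot/ccw_rot; rewrite /ccw -/(area _ _ _) -[area _ _ _]mul1r => h.
have [m Mm] := near_marked My (near_area h); rewrite mul1r => hm.
by exists m => //; exact: ccw_rot.
Qed.

(** The chords pq and xy cross. *)
Definition separ p q x y : Prop :=
  (ccw p x q /\ ccw p q y) \/ (ccw p y q /\ ccw p q x).

(** For a in M, p and q are the two neighbours of a; for an accumulation point
    a, they lie on both sides of a and so close to it that b, a', b' are not
    between them. In both cases a is the only one of the four points lying
    between p and q. *)
Lemma separating_arc a b a' b' : Mbar a -> Mbar b -> Mbar a' -> Mbar b' ->
  a <> b -> ~ neighbours (@ccw R) M a b -> a <> a' -> a <> b' ->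
  exists p q, [/\ M p, M q, p <> q, ~ neighbours (@ccw R) M p q &
    separ p q a b /\ ~ separ p q a' b'].
Proof.
move=> ha hb ha' hb' ab nab aa' ab'.
have s1 : (1 : R) = 1 \/ (1 : R) = -1 by left.
have sN1 : (-1 : R) = 1 \/ (-1 : R) = -1 by right.
have [q [Mq aq hq]] := close_marked s1 ha hb ha' hb' ab aa' ab'.
have [p [Mp ap hp]] := close_marked sN1 ha hb ha' hb' ab aa' ab'.
have {}hq x : x = b \/ x = a' \/ x = b' ->
    ccw a q x \/ x = q /\ next_ccw (@ccw R) M a q.
  move=> /hq [|[-> Ma n]]; first by rewrite mul1r; left.
  by right; split => //; exact: next_ccw_of_side.
have {}hp x : x = b \/ x = a' \/ x = b' ->
    ccw a x p \/ x = p /\ next_ccw (@ccw R) M p a.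
  move=> /hp [|[-> Ma n]]; first by rewrite mulN1r -area_swap; left.
  by right; split => //; exact: prev_ccw_of_side.
have aqb : ccw a q b.
  by have [//|[e n]] := hq b (or_introl erefl); case: nab; left; rewrite e.
have abp : ccw a b p.
  by have [//|[e n]] := hp b (or_introl erefl); case: nab; right; rewrite e.
have ca := closure_circle ha; have cb := closure_circle hb.
have cp : circle p by apply: closure_circle; left.
have cq : circle q by apply: closure_circle; left.
have aqp : ccw a q p := ccw_trans ca cq cb cp aqb abp.
have paq : ccw p a q by do 2 apply: ccw_rot.
have outside x : Mbar x -> ccw a q x -> ccw a x p -> ccw p q x.
  move=> /closure_circle cx h1 h2; apply: ccw_rot.
  by apply: (@ccw_trans _ x p a q) => //; [exact: ccw_rot | do 2 apply: ccw_rot].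
have pqb : ccw p q b by exact: outside.
have out x : x = b \/ x = a' \/ x = b' -> Mbar x -> ~ ccw p x q.
  move=> hx Mx h; have [px xq pq] := ccw_neq h.
  have [h1|[e _]] := hq x hx; last exact: xq.
  have [h2|[e _]] := hp x hx; last exact: px.
  exact: (ccw_asym h (outside x Mx h1 h2)).
exists p, q; split => //; first by have [] := ccw_neq pqb.
  case=> [[_ _ _ n]|[_ _ _ n]].
    by have [m Mm /(n m Mm)] := marked_between ha paq.
  by have [m Mm /(n m Mm)] := marked_between hb (ccw_rot pqb).
split; first by left.
by case=> -[h _]; apply: out h => //; right; [left | right].
Qed.

End Marking.

(** * The refined marking *)

Lemma eq_set2 (T : Type) (a b c d : T) :
  [set a; b] = [set c; d] -> (a = c /\ b = d) \/ (a = d /\ b = c).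
Proof.
move=> e.
have ha : [set c; d] a by rewrite -e; left.
have hb : [set c; d] b by rewrite -e; right.
have hc : [set a; b] c by rewrite e; left.
have hd : [set a; b] d by rewrite e; right.
case: ha hb hc hd => /= -> [] /= -> hc hd; [|by left|by right|].
  by case: hd => /= ->; left.
by case: hc => /= ->; left.
Qed.

Lemma image_set2 (T U : Type) (f : T -> U) (a b : T) :
  f @` [set a; b] = [set f a; f b].
Proof. by rewrite image_setU !image_set1. Qed.

Section RefinedMarking.
Variable R : realType.
Local Notation pt := (R * R)%type.
Local Notation pt' := (R * R * R)%type.
Variables (M : set pt) (zeta : pt -> int -> R).
Hypotheses (hM : admissible_marking M) (hz : added_points M zeta).
Implicit Types (p q x y z : pt) (a b c d : pt').

Local Notation Mbar := (M `|` limit_point M).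
Local Notation M' := (marking' M zeta).

Lemma marking'P a : M' a ->
  (M a.1 /\ a = (a.1, 0)) \/
  (limit_point M a.1 /\ exists j, a = (a.1, zeta a.1 j)).
Proof.
by case=> [[m Mm <-]|[z [j [lz ->]]]]; [left | right; split => //; exists j].
Qed.

Lemma marking'_closure a : M' a -> Mbar a.1.
Proof. by case/marking'P=> -[h _]; [left | right]. Qed.

Lemma marking'_marked a : M' a -> M a.1 -> a = (a.1, 0).
Proof. by case/marking'P=> -[h //] _ /(limit_not_marked hM h). Qed.

Lemma marking'_eq_fst a b : M' a -> M' b -> a.1 = b.1 -> a <> b ->
  exists z i j, [/\ limit_point M z, a = (z, zeta z i), b = (z, zeta z j) & i != j].
Proof.
move=> Ma Mb e ab; case/marking'P: (Ma) => -[h].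
  move=> ea; case: ab; rewrite ea e; apply/esym/marking'_marked => //.
  by rewrite -e.
move=> [i ea]; case/marking'P: (Mb) => -[h'].
  by move: h; rewrite e => /(limit_not_marked hM).
move=> [j eb]; exists a.1, i, j; split => //; first by rewrite {1}eb e.
by apply/eqP => ij; apply: ab; rewrite ea eb e ij.
Qed.

Lemma zeta_lt z i j : limit_point M z -> (zeta z i < zeta z j) = (i < j).
Proof. by move=> /hz [_ h _ _]; exact: (leW_mono (le_mono h)). Qed.

Lemma zeta_in z j : limit_point M z -> 0 < zeta z j < 1.
Proof. by move=> /hz [h _ _ _]. Qed.

Lemma ccw'_fst a b c : a.1 <> b.1 -> b.1 <> c.1 -> a.1 <> c.1 ->
  ccw' a b c -> ccw a.1 b.1 c.1.
Proof. by move=> ab bc ac [//|[[] //]|[[] //]|[[/esym //]]]. Qed.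

Lemma ccw_ccw' a b c : ccw a.1 b.1 c.1 -> ccw' a b c.
Proof. by move=> h; constructor 1. Qed.

Lemma ccw'_neq a b c : ccw' a b c -> [/\ a <> b, b <> c & a <> c].
Proof.
have h (u v : pt') : before u v -> u <> v by case=> _ + e; rewrite e ltxx.
have h' (u v w : pt') : before u v -> before v w -> u <> w.
  by case=> _ l1 [_ l2] e; move: (lt_trans l1 l2); rewrite e ltxx.
have n (u v : pt') : u.1 <> v.1 -> u <> v by move=> + e; rewrite e.
case=> [/ccw_neq [/n ? /n ? /n ?]//|[ab bca]|[bc cab]|[ca abc]].
- have ? := h _ _ ab; split => //.
    by case: bca => [/h//|hca e]; apply: hca; rewrite -e; case: ab.
  by case: bca => [/(h' _ _ _ ab)//|/n hca e]; apply: hca.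
- have ? := h _ _ bc; split => //.
    by case: cab => [/(h' _ _ _ bc) hba e|/n]; [apply: hba|].
  by case: cab => [/h hca e|hab e]; [apply: hca|apply: hab; rewrite e; case: bc].
- have hca := h _ _ ca; split => [||e]; last exact: hca.
    by case: abc => [/h//|hbc e]; apply: hbc; rewrite -e; case: ca.
  by case: abc => [/(h' _ _ _ ca) hcb e|/n//]; apply: hcb.
Qed.

Lemma marking'_neq_marked p a : M p -> M' a -> a <> (p, 0) -> a.1 <> p.
Proof. by move=> Mp Ma n e; apply: n; rewrite (marking'_marked Ma) e. Qed.

Lemma ccw'_marked p q a : M p -> M q -> M' a ->
  ccw' (p, 0) a (q, 0) -> ccw p a.1 q.
Proof.
move=> Mp Mq Ma h; have [n1 n2 n3] := ccw'_neq h.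
apply: (ccw'_fst _ _ _ h) => /=.
- by move=> e; apply: (marking'_neq_marked Mp Ma) => // ea; apply: n1.
- exact: (marking'_neq_marked Mq Ma).
- by move=> e; apply: n3; rewrite e.
Qed.

Lemma ccw'_rot a b c : ccw' a b c -> ccw' b c a.
Proof.
case=> [/ccw_rot|h|h|h]; [by constructor 1|by constructor 4| by constructor 2|].
by constructor 3.
Qed.

(** Collapsing the added intervals does not change whether an arc is crossed by
    an arc with both ends in M. *)
Lemma crossesP p q a b : M p -> M q -> p <> q -> M' a -> M' b ->
  crosses (@ccw' R) [set (p, 0); (q, 0)] [set a; b] <-> separ p q a.1 b.1.
Proof.
move=> Mp Mq pq Ma Mb; split; last first.
  case=> -[h1 h2]; [exists (p, 0), a, (q, 0), b | exists (p, 0), b, (q, 0), a];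
    split => //; [by split; exact: ccw_ccw' | by split; exact: ccw_ccw' |].
  by rewrite setUC.
suff H u v c d : M u -> M v -> u <> v -> M' c -> M' d ->
    cyc4 (@ccw' R) (u, 0) c (v, 0) d -> ccw u c.1 v /\ ccw u v d.1.
  move=> [a1 [a2 [a3 [a4 [h e1 e2]]]]].
  have {}e1 := eq_set2 e1; have {}e2 := eq_set2 e2.
  case: e1 h => -[<- <-] h; case: e2 h => -[<- <-] h.
  - by have [] := H _ _ _ _ Mp Mq pq Ma Mb h; left.
  - by have [] := H _ _ _ _ Mp Mq pq Mb Ma h; right.
  - have [h1 h2] := H _ _ _ _ Mq Mp (fun e => pq (esym e)) Ma Mb h.
    by right; split; [exact: ccw_rot | do 2 apply: ccw_rot].
  - have [h1 h2] := H _ _ _ _ Mq Mp (fun e => pq (esym e)) Mb Ma h.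
    by left; split; [exact: ccw_rot | do 2 apply: ccw_rot].
move=> Mu Mv uv Mc Md [h1 h2]; split; first exact: ccw'_marked h1.
by apply/ccw_rot/ccw_rot/(ccw'_marked Mv Mu Md); exact: ccw'_rot.
Qed.

Lemma separ_neq p q x y : separ p q x y -> x <> y.
Proof. by case=> -[h1 h2] e; apply: (ccw_asym h1); rewrite ?e// -e. Qed.

(** Seen from M, an added interval is a single point. *)
Lemma not_crosses_interval p q (l : set pt') : M p -> M q -> p <> q ->
  l `<=` M' -> in_added_interval M l ->
  ~ crosses (@ccw' R) [set (p, 0); (q, 0)] l /\
  ~ crosses (@ccw' R) l [set (p, 0); (q, 0)].
Proof.
move=> Mp Mq pq lM' [z lz hl].
have zp u : M u -> z <> u by move=> Mu e; apply: (limit_not_marked hM lz); rewrite e.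
split => -[a1 [a2 [a3 [a4 [[h1 h2] e1 e2]]]]].
  have l2 : l a2 by rewrite e2; left.
  have l4 : l a4 by rewrite e2; right.
  have [f2 _] := hl _ l2; have [f4 _] := hl _ l4.
  move: e2 lM' hl l2 l4 => -> lM' hl l2 l4.
  have := crossesP Mp Mq pq (lM' _ l2) (lM' _ l4).
  by case=> + _ => /(_ _)/separ_neq; apply; [exists a1, a2, a3, a4 | rewrite f2 f4].
have l1 : l a1 by rewrite e1; left.
have l3 : l a3 by rewrite e1; right.
have [f1 _] := hl _ l1; have [f3 _] := hl _ l3.
have inM b : [set a2; a4] b -> z <> b.1 by rewrite -e2 => -[] -> /=; exact: zp.
have f2 := inM a2 (or_introl erefl); have f4 := inM a4 (or_intror erefl).
have lt1 : before a3 a1.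
  case: h1 => [|[[+ _] _]|[[+ _] _]|[]//]; last by rewrite f3 => /esym.
    by rewrite /ccw -/(area _ _ _) f1 f3 area_xyx ltxx.
  by rewrite f1.
have lt2 : before a1 a3.
  case: h2 => [|[]//|[[+ _] _]|[[+ _] _]]; last by rewrite f1 => /esym.
    by rewrite /ccw -/(area _ _ _) f1 f3 area_xx ltxx.
  by rewrite f3.
by case: lt1 lt2 => _ lt1 [_ lt2]; have := lt_trans lt1 lt2; rewrite ltxx.
Qed.

Lemma next_marking' p q : next_ccw (@ccw R) M p q ->
  next_ccw (@ccw' R) M' (p, 0) (q, 0).
Proof.
case=> Mp Mq pq n; split; [by left; exists p|by left; exists q|by case|].
move=> c Mc /(ccw'_marked Mp Mq Mc) h.
by have [m Mm /(n m Mm)] := marked_between (marking'_closure Mc) h.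
Qed.

Lemma next_marking'_inv p q : M p -> M q ->
  next_ccw (@ccw' R) M' (p, 0) (q, 0) -> next_ccw (@ccw R) M p q.
Proof.
move=> Mp Mq [_ _ pq n]; split => // [e|c Mc h]; first by apply: pq; rewrite e.
by apply: (n (c, 0)); [left; exists c | exact: ccw_ccw'].
Qed.

(** Travelling from z_j to a point outside the added interval of z one meets
    z_(j+1), and on the way back z_(j-1). *)
Lemma added_not_neighbours z j d : limit_point M z -> d.1 <> z ->
  ~ neighbours (@ccw' R) M' (z, zeta z j) d.
Proof.
move=> lz dz [[_ _ _ /(_ (z, zeta z (j + 1)))]|[_ _ _ /(_ (z, zeta z (j - 1)))]].
  apply; first by right; exists z, (j + 1).
  by constructor 2; split; [split => //=; rewrite zeta_lt// ltrDl | right].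
apply; first by right; exists z, (j - 1).
constructor 3; split; last by right.
by split => //=; rewrite zeta_lt// gtrDl.
Qed.

Lemma added_next z j : limit_point M z ->
  next_ccw (@ccw' R) M' (z, zeta z (j - 1)) (z, zeta z j).
Proof.
move=> lz; split; [by right; exists z, (j - 1) | by right; exists z, j | |].
  by case=> /eqP; rewrite lt_eqF// zeta_lt// gtrDl.
move=> c Mc; set a := (z, zeta z (j - 1)); set b := (z, zeta z j).
have ab : before a b by split => //=; rewrite zeta_lt// gtrDl.
have nba : ~ before b a.
  by move=> [_ h]; case: ab => _ h'; have := lt_trans h h'; rewrite ltxx.
case=> [|[ac [cb|//]]|[cb [//|ac]]|[] //].
- by rewrite /ccw -/(area _ _ _) area_xyx ltxx.
- have /marking'P [[Mc1 _]|[_ [i ci]]] := Mc.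
    by case: ac => /= e _; apply: (limit_not_marked hM lz); rewrite e.
  case: ac cb => /= ez; rewrite ci -ez zeta_lt// => l1 [_ /=]; rewrite zeta_lt//.
  by move=> l2; move: l1 l2; lia.
- by apply: ac; case: cb.
Qed.

Lemma added_not_neighbours_interval z i j : limit_point M z -> i < j ->
  ~ neighbours (@ccw' R) M' (z, zeta z j) (z, zeta z (i - 1)).
Proof.
move=> lz ij [[_ _ _ /(_ (z, zeta z (j + 1)))]|[_ _ _ /(_ (z, zeta z i))]].
  apply; first by right; exists z, (j + 1).
  by constructor 4; split; [|left]; split => //=; rewrite zeta_lt//; lia.
apply; first by right; exists z, i.
by constructor 2; split; [|left]; split => //=; rewrite zeta_lt//; lia.
Qed.

Lemma closure_lift x : Mbar x -> exists2 a, M' a & a.1 = x.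
Proof.
case=> [Mx|lx]; first by exists (x, 0) => //; left; exists x.
by exists (x, zeta x 0) => //; right; exists x, 0.
Qed.
End RefinedMarking.

(** * Direct sums in linear categories *)

Lemma isomorphic_refl (C : category) (X : C) : isomorphic X X.
Proof. by exists (idm X), (idm X); rewrite comp1m. Qed.

Lemma isomorphic_sym (C : category) (X Y : C) : isomorphic X Y -> isomorphic Y X.
Proof. by case=> f [g [gf fg]]; exists g, f. Qed.

Lemma isomorphic_trans (C : category) (X Y Z : C) :
  isomorphic X Y -> isomorphic Y Z -> isomorphic X Z.
Proof.
case=> f [f' [h1 h2]] [g [g' [h3 h4]]]; exists (g \com f), (f' \com g'); split.
  by rewrite -Defs.compA [g' \com _]Defs.compA h3 comp1m.
by rewrite -Defs.compA [f \com _]Defs.compA h2 comp1m.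
Qed.

Lemma isomorphic_fun (C D : category) (F : functor C D) (X Y : C) :
  isomorphic X Y -> isomorphic (F X) (F Y).
Proof.
case=> f [g [gf fg]]; exists (Defs.fmap F f), (Defs.fmap F g).
by rewrite -!Defs.fmapM gf fg !Defs.fmap1.
Qed.

Section LinearCategory.
Variables (k : fieldType) (C : lincat k).
Implicit Types X Y Z A B S : C.

Lemma lcomp0l X Y Z (f : lhom X Y) : (0 : lhom Y Z) \lcom f = 0.
Proof.
have := @lcomp_linear_l k C X Y Z f (-1) 0 0.
by rewrite scaleN1r oppr0 addr0 scaleN1r addNr.
Qed.

Lemma lcomp0r X Y Z (g : lhom Y Z) : g \lcom (0 : lhom X Y) = 0.
Proof.
have := @lcomp_linear_r k C X Y Z g (-1) 0 0.
by rewrite scaleN1r oppr0 addr0 scaleN1r addNr.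
Qed.

Lemma lcompDl X Y Z (f : lhom X Y) (g g' : lhom Y Z) :
  (g + g') \lcom f = g \lcom f + g' \lcom f.
Proof. by have := lcomp_linear_l f 1 g g'; rewrite !scale1r. Qed.

Lemma lcompDr X Y Z (g : lhom Y Z) (f f' : lhom X Y) :
  g \lcom (f + f') = g \lcom f + g \lcom f'.
Proof. by have := lcomp_linear_r g 1 f f'; rewrite !scale1r. Qed.

Lemma lcompZr X Y Z (g : lhom Y Z) a (f : lhom X Y) :
  g \lcom (a *: f) = a *: (g \lcom f).
Proof. by have := lcomp_linear_r g a f 0; rewrite lcomp0r !addr0. Qed.

Lemma lcompNl X Y Z (f : lhom X Y) (g : lhom Y Z) : (- g) \lcom f = - (g \lcom f).
Proof. by apply: (addrI (g \lcom f)); rewrite -lcompDl !subrr lcomp0l. Qed.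

Lemma lcompNr X Y Z (g : lhom Y Z) (f : lhom X Y) : g \lcom (- f) = - (g \lcom f).
Proof. by apply: (addrI (g \lcom f)); rewrite -lcompDr !subrr lcomp0r. Qed.

Lemma lcomp_suml X Y Z (I : finType) (f : lhom X Y) (g : I -> lhom Y Z) :
  (\sum_i g i) \lcom f = \sum_i (g i \lcom f).
Proof.
by apply: (big_morph (fun g => g \lcom f)) => [x y|]; rewrite ?lcompDl ?lcomp0l.
Qed.

Lemma lcomp_sumr X Y Z (I : finType) (g : lhom Y Z) (f : I -> lhom X Y) :
  g \lcom (\sum_i f i) = \sum_i (g \lcom f i).
Proof.
by apply: (big_morph (fun f => g \lcom f)) => [x y|]; rewrite ?lcompDr ?lcomp0r.
Qed.

Lemma lin_isoP X Y : isomorphic (X : cat_of C) Y <->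
  exists (f : lhom X Y) (g : lhom Y X), g \lcom f = lid X /\ f \lcom g = lid Y.
Proof. by split; case=> f [g h]; exists f, g. Qed.

Lemma from_zero X Y (f : lhom X Y) : is_zero X -> f = 0.
Proof. by rewrite /is_zero -[f]lcompm1 => ->; rewrite lcomp0r. Qed.

Lemma to_zero X Y (f : lhom X Y) : is_zero Y -> f = 0.
Proof. by rewrite /is_zero -[f]lcomp1m => ->; rewrite lcomp0l. Qed.

Lemma zero_iso X Y : is_zero X -> is_zero Y -> isomorphic (X : cat_of C) Y.
Proof.
by move=> hX hY; apply/lin_isoP; exists 0, 0; rewrite !lcomp0l hX hY.
Qed.

Lemma iso_zero X Y : isomorphic (X : cat_of C) Y -> is_zero X -> is_zero Y.
Proof.
by case/lin_isoP => f [g [_ fg]] hX; rewrite /is_zero -fg (from_zero f hX) lcomp0l.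
Qed.

Lemma dsum2P A B S : is_dsum2 A B S <->
  exists (i : lhom A S) (j : lhom B S) (p : lhom S A) (q : lhom S B),
    [/\ p \lcom i = lid A, q \lcom j = lid B, q \lcom i = 0, p \lcom j = 0
      & i \lcom p + j \lcom q = lid S].
Proof.
split.
  case=> inj [proj [h1 h2 h3]].
  exists (inj true), (inj false), (proj true), (proj false); split.
  - exact: (h1 true).
  - exact: (h1 false).
  - exact: (h2 true false isT).
  - exact: (h2 false true isT).
  - by rewrite -h3 big_bool.
case=> i [j [p [q [h1 h2 h3 h4 h5]]]].
exists (fun b : bool => if b return lhom (if b then A else B) S then i else j).
exists (fun b : bool => if b return lhom S (if b then A else B) then p else q).
by split; [case | case=> -[] | rewrite big_bool].
Qed.

Lemma dsum2_iso A B S A' B' S' : isomorphic (A : cat_of C) A' ->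
  isomorphic (B : cat_of C) B' -> isomorphic (S : cat_of C) S' ->
  is_dsum2 A B S -> is_dsum2 A' B' S'.
Proof.
case/lin_isoP => a [a' [a1 a2]] /lin_isoP [b [b' [b1 b2]]] /lin_isoP [s [s' [s1 s2]]].
case/dsum2P => i [j [p [q [h1 h2 h3 h4 h5]]]]; apply/dsum2P.
exists (s \lcom i \lcom a'), (s \lcom j \lcom b'), (a \lcom p \lcom s'), (b \lcom q \lcom s').
have cancel (X Y T U : C) (x : lhom T U) (y : lhom S T) (y' : lhom Y S) (x' : lhom X Y) :
    (x \lcom y \lcom s') \lcom (s \lcom y' \lcom x') = x \lcom (y \lcom y') \lcom x'.
  by rewrite !lcompA -[_ \lcom s' \lcom s]lcompA s1 lcompm1.
split; rewrite ?cancel ?h1 ?h2 ?h3 ?h4 ?lcompm1 ?lcomp0r ?lcomp0l//.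
have cancel2 (X Y Z T : C) (x : lhom T Z) (y : lhom Y T) (y' : lhom T Y) (x' : lhom X T)
    (e : y \lcom y' = lid T) : (x \lcom y) \lcom (y' \lcom x') = x \lcom x'.
  by rewrite lcompA -[x \lcom y \lcom y']lcompA e lcompm1.
rewrite -[a \lcom p \lcom s']lcompA -[b \lcom q \lcom s']lcompA.
rewrite (cancel2 _ _ _ _ _ _ _ _ a1) (cancel2 _ _ _ _ _ _ _ _ b1).
transitivity (s \lcom (i \lcom p + j \lcom q) \lcom s').
  by rewrite lcompDr lcompDl !lcompA.
by rewrite h5 lcompm1.
Qed.

Lemma dsum2_zerol A B S : is_zero A -> is_dsum2 A B S -> isomorphic (B : cat_of C) S.
Proof.
move=> hA /dsum2P [i [j [p [q [h1 h2 h3 h4 h5]]]]]; apply/lin_isoP; exists j, q.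
by split => //; rewrite -h5 (from_zero i hA) lcomp0l add0r.
Qed.

Lemma dsum2_sym A B S : is_dsum2 A B S -> is_dsum2 B A S.
Proof.
move=> /dsum2P [i [j [p [q [h1 h2 h3 h4 h5]]]]]; apply/dsum2P.
by exists j, i, q, p; split => //; rewrite addrC.
Qed.

Lemma dsum2_zeror A B S : is_zero B -> is_dsum2 A B S -> isomorphic (A : cat_of C) S.
Proof. by move=> hB /dsum2_sym; exact: dsum2_zerol. Qed.

Lemma dsum2_uniq A B S S' : is_dsum2 A B S -> is_dsum2 A B S' ->
  isomorphic (S : cat_of C) S'.
Proof.
move=> /dsum2P [i [j [p [q [h1 h2 h3 h4 h5]]]]].
move=> /dsum2P [i' [j' [p' [q' [h1' h2' h3' h4' h5']]]]]; apply/lin_isoP.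
have mid (X Y Z T : C) (x : lhom Y Z) (y : lhom T Y) (y' : lhom Y T) (x' : lhom X Y) :
    (x \lcom y) \lcom (y' \lcom x') = x \lcom (y \lcom y') \lcom x'.
  by rewrite !lcompA.
exists (i' \lcom p + j' \lcom q), (i \lcom p' + j \lcom q'); split.
  rewrite lcompDl !lcompDr !lcompA -![_ \lcom _ \lcom i']lcompA -![_ \lcom _ \lcom j']lcompA.
  by rewrite h1' h2' h3' h4' !lcompm1 !lcomp0r !lcomp0l addr0 add0r.
rewrite lcompDl !lcompDr !lcompA -![_ \lcom _ \lcom i]lcompA -![_ \lcom _ \lcom j]lcompA.
by rewrite h1 h2 h3 h4 !lcompm1 !lcomp0r !lcomp0l addr0 add0r.
Qed.

Lemma dsum_zero (I : finType) (X : I -> C) S :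
  (forall i, is_zero (X i)) -> is_dsum X S -> is_zero S.
Proof.
move=> hX [inj [proj [_ _ e]]]; rewrite /is_zero -e.
by rewrite big1// => i _; rewrite (from_zero (inj i))// lcomp0l.
Qed.

(** Peeling off one summand is what allows induction on the number of summands. *)
Lemma dsum_split n (X : 'I_n.+1 -> C) S T :
  is_dsum X S -> is_dsum (fun j => X (lift ord0 j)) T -> is_dsum2 (X ord0) T S.
Proof.
move=> [i [p [h1 h2 h3]]] [i' [p' [h1' h2' h3']]]; apply/dsum2P.
exists (i ord0), (\sum_j (i (lift ord0 j) \lcom p' j)), (p ord0),
  (\sum_j (i' j \lcom p (lift ord0 j))).
split => //.
- rewrite lcomp_suml -h3'; apply: eq_bigr => j _; rewrite lcomp_sumr (bigD1 j)//=.
  rewrite big1 ?addr0.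
    by rewrite !lcompA -[i' j \lcom _ \lcom _]lcompA h1 lcompm1.
  move=> j' jj'; rewrite !lcompA -[i' j \lcom _ \lcom _]lcompA h2 ?lcomp0r ?lcomp0l//.
- by rewrite lcomp_suml big1// => j _; rewrite -lcompA h2 ?lcomp0r.
- by rewrite lcomp_sumr big1// => j _; rewrite lcompA h2 ?lcomp0l.
- rewrite -h3 big_ord_recl; congr (_ + _).
  rewrite lcomp_suml; apply: eq_bigr => j _; rewrite lcomp_sumr (bigD1 j)//=.
  rewrite big1 ?addr0.
    by rewrite !lcompA -[i _ \lcom _ \lcom _]lcompA h1' lcompm1.
  move=> j' jj'; rewrite !lcompA -[i _ \lcom _ \lcom _]lcompA h2' ?lcomp0r ?lcomp0l//.
Qed.

(** If X is A + B, the two complementary idempotents add up to the identity, so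
    one of them is invertible, hence equal to the identity. *)
Lemma local_end_indecomposable X : local_end X -> indecomposable X.
Proof.
case=> nz hadd; split => // A B /dsum2P [i [j [p [q [h1 h2 h3 h4 h5]]]]].
have idem A' (i' : lhom A' X) (p' : lhom X A') : p' \lcom i' = lid A' ->
    is_iso (i' \lcom p' : @Defs.Hom C X X) -> i' \lcom p' = lid X.
  move=> e [g [gf _]]; have {}gf : g \lcom (i' \lcom p') = lid X by [].
  rewrite -{1}[i' \lcom p']lcomp1m -{1}gf -lcompA.
  suff -> : (i' \lcom p') \lcom (i' \lcom p') = i' \lcom p' by [].
  by rewrite lcompA -[_ \lcom p' \lcom i']lcompA e lcompm1.
have zero_of A' (i' : lhom A' X) (p' : lhom X A') : p' \lcom i' = lid A' ->
    i' \lcom p' = 0 -> is_zero A'.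
  move=> e1 e2; have : (p' \lcom i') \lcom (p' \lcom i') = 0.
    by rewrite lcompA -[p' \lcom i' \lcom p']lcompA e2 lcomp0r lcomp0l.
  by rewrite e1 lcomp1m.
have [h|h] := pselect (is_iso (i \lcom p : @Defs.Hom C X X)).
  right; apply: (zero_of _ j q h2); apply: (addrI (i \lcom p)).
  by rewrite h5 addr0 (idem _ _ _ h1 h).
have [h'|h'] := pselect (is_iso (j \lcom q : @Defs.Hom C X X)).
  left; apply: (zero_of _ i p h1); apply: (addIr (j \lcom q)).
  by rewrite h5 add0r (idem _ _ _ h2 h').
by case: (hadd _ _ h h'); exists (lid X); rewrite h5 /= lcomp1m.
Qed.

Lemma iso_indecomposable X Y : isomorphic (X : cat_of C) Y ->
  indecomposable X -> indecomposable Y.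
Proof.
move=> XY [nz hX]; split.
  by move=> hY; apply: nz; apply: iso_zero hY; exact: isomorphic_sym.
move=> A B hAB; apply: hX; apply: dsum2_iso hAB; try exact: isomorphic_refl.
exact: isomorphic_sym.
Qed.

End LinearCategory.

Section LinearFunctor.
Variables (k : fieldType) (C D : lincat k) (F : functor C D).
Hypothesis hF : is_linear F.
Implicit Types X Y Z A B S : C.

Lemma lmap_id X : lmap F (lid X) = lid (F X : D).
Proof. exact: (Defs.fmap1 F X). Qed.

Lemma lmap_comp X Y Z (g : lhom Y Z) (f : lhom X Y) :
  lmap F (g \lcom f) = lmap F g \lcom lmap F f.
Proof. exact: (Defs.fmapM F g f). Qed.

Lemma lmap0 X Y : lmap F (0 : lhom X Y) = 0.
Proof.
have := @hF X Y (-1) 0 0.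
by rewrite scaleN1r oppr0 addr0 scaleN1r addNr.
Qed.

Lemma lmapD X Y (f g : lhom X Y) : lmap F (f + g) = lmap F f + lmap F g.
Proof. by have := hF 1 f g; rewrite !scale1r. Qed.

Lemma lmap_sum X Y (I : finType) (f : I -> lhom X Y) :
  lmap F (\sum_i f i) = \sum_i lmap F (f i).
Proof. by apply: (big_morph (lmap F)) => [x y|]; rewrite ?lmapD ?lmap0. Qed.

Lemma lmap_zero X : is_zero X -> is_zero (F X : D).
Proof. by rewrite /is_zero -lmap_id => ->; rewrite lmap0. Qed.

Lemma lmap_dsum2 A B S : is_dsum2 A B S -> is_dsum2 (F A : D) (F B : D) (F S : D).
Proof.
move=> /dsum2P [i [j [p [q [h1 h2 h3 h4 h5]]]]]; apply/dsum2P.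
exists (lmap F i), (lmap F j), (lmap F p), (lmap F q).
by rewrite -!lmap_comp h1 h2 h3 h4 -lmapD h5 !lmap0 !lmap_id.
Qed.

Lemma lmap_dsum (I : finType) (X : I -> C) S : is_dsum X S ->
  is_dsum (fun i => F (X i) : D) (F S).
Proof.
move=> [i [p [h1 h2 h3]]].
exists (fun x => lmap F (i x)), (fun x => lmap F (p x)); split.
- by move=> x; rewrite -lmap_comp h1 lmap_id.
- by move=> x y xy; rewrite -lmap_comp h2// lmap0.
- by rewrite -lmap_id -h3 lmap_sum; apply: eq_bigr => x _; rewrite lmap_comp.
Qed.
End LinearFunctor.

(** * Localizations of categories *)

Section Localization.
Variables (C D : category) (Q : functor C D) (W : morphism_class C).
Hypothesis hQ : is_localization Q W.

(** F factors through Q up to natural isomorphism. *)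
Lemma localization_isomorphic (E : category) (F : functor C E) :
  inverts F W -> forall X Y : C, isomorphic (Q X) (Q Y) -> isomorphic (F X) (F Y).
Proof.
move=> hF X Y hXY; have [G [eta [_ eta_iso]]] := (hQ.2 E).1 F hF.
apply: (@isomorphic_trans _ _ (G (Q X))).
  by apply: isomorphic_sym; exists (eta X); exact: eta_iso.
apply: (@isomorphic_trans _ _ (G (Q Y))); first exact: isomorphic_fun.
by exists (eta Y); exact: eta_iso.
Qed.

(** The full subcategory of D on the objects Q X, presented with the objects
    of C. *)
Definition full_image : category :=
  @Category C (fun X Y => Defs.Hom (Q X) (Q Y)) (fun X => idm (Q X))
    (fun X Y Z g f => g \com f) (fun X Y f => comp1m f) (fun X Y f => compm1 f)
    (fun X Y Z U h g f => Defs.compA h g f).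

Definition to_full_image : functor C full_image :=
  @Functor C full_image (fun X => X) (fun X Y f => Defs.fmap Q f)
    (fun X => fmap1 Q X) (fun X Y Z g f => fmapM Q g f).

Definition of_full_image : functor full_image D :=
  @Functor full_image D (fun X => Q X) (fun X Y f => f)
    (fun X => erefl) (fun X Y Z g f => erefl).

Definition fun_id (E : category) : functor E E :=
  @Functor E E (fun X => X) (fun X Y f => f) (fun X => erefl)
    (fun X Y Z g f => erefl).

(** The corestriction of Q to its full image inverts W, so it factors as G
    after Q, up to isomorphism. The composite of G with the inclusion and the
    identity functor of D then agree after Q, hence are isomorphic, and
    Y is isomorphic to the image under Q of G Y. *)
Lemma localization_ess_surj (Y : D) : exists X : C, isomorphic Y (Q X).
Proof.
have inv : inverts to_full_image W by move=> X X' f /hQ.1.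
have [G [eta [eta_nat eta_iso]]] := (hQ.2 _).1 _ inv.
pose K := fcomp of_full_image G.
pose eta' X : Defs.Hom (fcomp K Q X) (fcomp (fun_id D) Q X) := eta X.
have eta'_nat : is_natural eta' by move=> X X' f; exact: eta_nat.
have inv_ex X : exists g : Defs.Hom (fcomp (fun_id D) Q X) (fcomp K Q X),
    g \com eta' X = idm _ /\ eta' X \com g = idm _ by exact: eta_iso.
pose eps X := projT1 (cid (inv_ex X)).
have eps1 X : eps X \com eta' X = idm _ := (projT2 (cid (inv_ex X))).1.
have eps2 X : eta' X \com eps X = idm _ := (projT2 (cid (inv_ex X))).2.
have eps_nat : is_natural eps.
  move=> X X' f; rewrite -[LHS]comp1m -eps1 -Defs.compA [eta' X' \com _]Defs.compA.
  by rewrite -eta'_nat -[_ \com eta' X \com _]Defs.compA eps2 compm1.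
have [theta [th_nat thE _]] := (hQ.2 D).2 _ _ _ eta'_nat.
have [phi [ph_nat phE _]] := (hQ.2 D).2 _ _ _ eps_nat.
have uniq (H : functor D D) (mu : forall Z, Defs.Hom (H Z) (H Z)) : is_natural mu ->
    (forall X, mu (Q X) = idm _) -> forall Z, mu Z = idm _.
  move=> mu_nat muE Z.
  have id_nat : is_natural (fun Z => idm (H Z)).
    by move=> ? ? f; rewrite compm1 comp1m.
  have id_nat' : @is_natural _ _ (fcomp H Q) (fcomp H Q) (fun X => idm (H (Q X))).
    by move=> ? ? f; rewrite compm1 comp1m.
  have [nu [_ _ nu_uniq]] := (hQ.2 D).2 H H _ id_nat'.
  by rewrite (nu_uniq _ mu_nat muE) (nu_uniq _ id_nat).
exists (G Y : C); exists (phi Y), (theta Y); split.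
  apply: (uniq (fun_id D) (fun Z => theta Z \com phi Z)) => [A B f|X].
    by rewrite Defs.compA th_nat -!Defs.compA ph_nat.
  by rewrite thE phE eps2.
apply: (uniq K (fun Z => phi Z \com theta Z)) => [A B f|X].
  by rewrite Defs.compA ph_nat -!Defs.compA th_nat.
by rewrite thE phE eps1.
Qed.

End Localization.

(** * Hom functors of triangulated categories *)

Section Triangulated.
Variables (k : fieldType) (C : triangulated k).
Implicit Types P X Y Z A B : C.

Local Notation "f ^[1]" := (lmap (suspension C) f) (at level 2, format "f ^[1]").

Lemma zero_object : exists Z : C, is_zero Z.
Proof.
have [Z hZ] := tadditive (fun i : 'I_0 =>
  match i with Ordinal _ h => False_rect C (notF h) end).
by exists Z; apply: dsum_zero hZ => -[].
Qed.

(** A map y with g y = 0 gives a map from the rotation of the triangle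
    P = P -> 0 to the rotation of the given one. *)
Lemma triangle_exact P X Y Z (f : lhom X Y) (g : lhom Y Z)
    (h : lhom Z (suspension C X : C)) (y : lhom P Y) :
  dist f g h -> g \lcom y = 0 -> exists x : lhom P X, f \lcom x = y.
Proof.
move=> fgh gy; have [Z0 hZ0] := zero_object.
have t1 := (dist_rotate _ _ _).1 (dist_id P hZ0).
have t2 := (dist_rotate _ _ _).1 fgh.
have [|w [_ hw]] := dist_fill (u := y) (v := (0 : lhom Z0 Z)) t1 t2.
  by rewrite gy lcomp0l.
have [s sK Ks] := shift_ff P X; exists (s w).
have [s' s'K _] := shift_ff P Y; apply: (can_inj s'K).
rewrite lmap_comp Ks; move: hw.
by rewrite lcompNr lcompNl lmap_id lcompm1 => /oppr_inj.
Qed.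

Lemma susp_bijective P X Y Z (f : lhom X Y) (g : lhom Y Z)
    (h : lhom Z (suspension C X : C)) :
  dist f g h -> hom_is_0 P Z -> hom_is_0 P (susp Z) ->
  bijective (fun x : lhom P (susp X) => f^[1] \lcom x).
Proof.
move=> fgh PZ PZ1.
have t2 := (dist_rotate _ _ _).1 ((dist_rotate _ _ _).1 fgh).
have t3 := (dist_rotate _ _ _).1 t2.
have ker (x : lhom P (susp X)) : f^[1] \lcom x = 0 -> x = 0.
  move=> fx; have [|z <-] := triangle_exact (y := x) t2.
    by rewrite lcompNl fx oppr0.
  by rewrite (PZ z) lcomp0r.
have surj (y : lhom P (susp Y)) : exists x : lhom P (susp X), f^[1] \lcom x = y.
  have [|x hx] := triangle_exact (y := y) t3; first exact: PZ1.
  by exists (- x); rewrite lcompNr -lcompNl.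
have [s hs] := choice surj.
exists s => // x; apply/subr0_eq/ker.
by rewrite lcompDr lcompNr hs subrr.
Qed.

Section HomTest.
Variable P : C.

(** The functor X |-> Hom(P, X[1]) is given the values X themselves, with the
    linear maps Hom(P, X[1]) -> Hom(P, Y[1]) as morphisms X -> Y: this keeps the
    target category as small as C. *)
Record lin_map X Y := LinMap {
  lin_fun :> lhom P (susp X) -> lhom P (susp Y);
  lin_funP : forall a u v, lin_fun (a *: u + v) = a *: lin_fun u + lin_fun v }.

Lemma lin_map_eq X Y (phi psi : lin_map X Y) : (forall x, phi x = psi x) -> phi = psi.
Proof.
case: phi psi => [f hf] [g hg] /= /funext e.
by move: hf hg; rewrite e => hf hg; congr LinMap; exact: Prop_irrelevance.
Qed.

Definition lin_map_id X : lin_map X X := @LinMap X X (fun x => x) (fun a u v => erefl).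

Lemma lin_map_comp_subproof X Y Z (psi : lin_map Y Z) (phi : lin_map X Y) a u v :
  psi (phi (a *: u + v)) = a *: psi (phi u) + psi (phi v).
Proof. by rewrite !lin_funP. Qed.

Definition lin_map_comp X Y Z (psi : lin_map Y Z) (phi : lin_map X Y) : lin_map X Z :=
  LinMap (lin_map_comp_subproof psi phi).

Definition hom_category : category.
Proof.
apply: (@Category C lin_map lin_map_id lin_map_comp) => *; exact: lin_map_eq.
Defined.

Definition hom_functor_map X Y (f : lhom X Y) : lin_map X Y :=
  @LinMap X Y (fun x => f^[1] \lcom x) (lcomp_linear_r (f^[1])).

Definition hom_functor : functor C hom_category.
Proof.
apply: (@Functor C hom_category (fun X => X) hom_functor_map).
  by move=> X; apply: lin_map_eq => x /=; rewrite -[RHS]lcomp1m -lmap_id.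
move=> X Y Z g f; apply: lin_map_eq => x /=.
by rewrite lcompA; congr (_ \lcom x); exact: lmap_comp.
Defined.

Lemma hom_functor_inverts (D : C -> Prop) :
  (forall Z, D Z -> hom_is_0 P Z /\ hom_is_0 P (susp Z)) ->
  inverts hom_functor (cone_in D).
Proof.
move=> hD X Y f [Z [g [h [fgh /hD [PZ PZ1]]]]].
have [s sK Ks] := susp_bijective fgh PZ PZ1.
have slin a u v : s (a *: u + v) = a *: s u + s v.
  by apply: (can_inj sK); rewrite lcomp_linear_r !Ks.
exists (LinMap slin : @Defs.Hom hom_category Y X).
by split; apply: lin_map_eq => x /=; [exact: sK | exact: Ks].
Qed.

End HomTest.

(** If P is left orthogonal to D and D[1], the functor Hom(P, -[1]) is an
    invariant of the quotient by D. *)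
Lemma quotient_hom (D : C -> Prop) (Cbar : category) (Q : functor C Cbar) P X Y :
  is_localization Q (cone_in D) ->
  (forall Z, D Z -> hom_is_0 P Z /\ hom_is_0 P (susp Z)) ->
  isomorphic (Q X) (Q Y) ->
  exists phi : lhom P (susp X) -> lhom P (susp Y),
    (forall a u v, phi (a *: u + v) = a *: phi u + phi v) /\ bijective phi.
Proof.
move=> hQ hD hXY.
have [f [g [gf fg]]] := localization_isomorphic hQ (hom_functor_inverts hD) hXY.
exists (lin_fun f); split; first exact: lin_funP f.
by exists (lin_fun g) => x; [have := congr1 (fun h => lin_fun h x) gf
  | have := congr1 (fun h => lin_fun h x) fg].
Qed.

(** The suspension is an additive equivalence. *)
Lemma susp_indecomposable X : indecomposable X -> indecomposable (susp X).
Proof.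
move=> [nz hX]; have faithful (A B : C) : injective (fun f : lhom A B => f^[1]).
  by have [s sK _] := shift_ff A B; exact: can_inj sK.
have lin := @shift_linear k C.
split=> [h|A B hAB].
  by apply: nz; apply: faithful; rewrite lmap_id lmap0.
have [A' hA] := shift_surj A; have [B' hB] := shift_surj B.
have := dsum2_iso (isomorphic_sym hA) (isomorphic_sym hB) (isomorphic_refl _) hAB.
case/dsum2P => i [j [p [q [h1 h2 h3 h4 h5]]]].
have full (E F : C) (g : lhom (susp E) (susp F)) : exists f : lhom E F, f^[1] = g.
  by have [s _ Ks] := shift_ff E F; exists (s g); rewrite Ks.
have [i' ei] := full _ _ i; have [j' ej] := full _ _ j.
have [p' ep] := full _ _ p; have [q' eq] := full _ _ q.
have [|/(lmap_zero lin) h|/(lmap_zero lin) h] := hX A' B'.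
- apply/dsum2P; exists i', j', p', q'; split; apply: faithful.
  + by rewrite lmap_comp ei ep h1 lmap_id.
  + by rewrite lmap_comp ej eq h2 lmap_id.
  + by rewrite lmap_comp ei eq h3 lmap0.
  + by rewrite lmap_comp ej ep h4 lmap0.
  + by rewrite lmapD// !lmap_comp ei ej ep eq h5 lmap_id.
- by left; apply: iso_zero h.
- by right; apply: iso_zero h.
Qed.

(** In a perfect pairing with the zero space, f and 0 represent the same
    functional. *)
Lemma two_CY_hom0 X Y : two_CY C -> hom_is_0 Y (susp (susp X)) -> hom_is_0 X Y.
Proof.
case=> pair [_ lin_r perfect _] h f.
have pair0 (f' : lhom X Y) g : pair X Y f' g = 0.
  rewrite (h g); have := lin_r X Y f' (-1) 0 0.
  by rewrite scaler0 addr0 mulN1r addNr.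
have [f0 [_ uniq]] := perfect X Y (\0 : {linear lhom Y (susp (susp X)) -> k^o}).
have e0 : f0 = f by apply: uniq => g; exact: pair0.
have e1 : f0 = 0 by apply: uniq => g; exact: pair0.
by rewrite -e0 e1.
Qed.

End Triangulated.

(** * The quotient of the discrete cluster category *)

Lemma linear_at0 (k : fieldType) (U V : lmodType k) (phi : U -> V) :
  (forall (t : k) u v, phi (t *: u + v) = t *: phi u + phi v) -> phi 0 = 0.
Proof. by move=> /(_ (-1) 0 0); rewrite scaler0 addr0 scaleN1r addNr. Qed.

Section ClusterQuotient.
Variables (R : realType) (k : closedFieldType) (M : set (R * R)).
Variables (zeta : R * R -> int -> R) (C : triangulated k).
Variables (ell : C -> set (R * R * R)) (Cbar : lincat k) (Q : functor C Cbar).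
Hypotheses (hM : admissible_marking M) (hz : added_points M zeta).
Hypothesis hC : is_discrete_cluster_category (@ccw' R) (marking' M zeta) ell.
Hypothesis hQlin : is_linear Q.
Hypothesis hQ : is_localization Q (cone_in (added_subcategory M ell)).

Local Notation pt := (R * R)%type.
Local Notation pt' := (R * R * R)%type.
Local Notation Mbar := (M `|` limit_point M).
Local Notation M' := (marking' M zeta).
Implicit Types (a b c d : pt') (p q x y z : pt) (P X Y Z : C).

Lemma indec_ends X : indecomposable X -> exists a b,
  [/\ M' a, M' b, a <> b, ~ neighbours (@ccw' R) M' a b & ell X = [set a; b]].
Proof. by case: (dcc_arcs hC) => h _ _ /h. Qed.

Lemma ends_not_neighbours X a b : indecomposable X -> ell X = [set a; b] ->
  ~ neighbours (@ccw' R) M' a b.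
Proof.
move=> iX eX; have [c [d [_ _ _ n]]] := indec_ends iX; rewrite eX => E.
by case: (eq_set2 E) => -[-> ->] // [] h; apply: n; [right | left].
Qed.

Lemma exists_represents a b : M' a -> M' b -> a <> b ->
  exists X, represents (@ccw' R) M' ell a b X.
Proof.
move=> Ma Mb ab; have [n|n] := pselect (neighbours (@ccw' R) M' a b).
  by have [Z hZ] := zero_object C; exists Z.
have [_ _ h] := dcc_arcs hC; have [|X iX eX] := h [set a; b].
  by exists a, b.
by exists X.
Qed.

Lemma ell_in X a : indecomposable X -> ell X a -> M' a.
Proof. by move=> /indec_ends [b [c [Mb Mc _ _ ->]]] []->. Qed.

Lemma iso_of_ell X Y : indecomposable X -> indecomposable Y -> ell X = ell Y ->
  isomorphic (X : cat_of C) Y.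
Proof. by case: (dcc_arcs hC) => _ h _ iX iY /(h _ _ iX iY). Qed.

Definition marked_arc P p q : Prop :=
  [/\ indecomposable P, M p, M q, p <> q & ell P = [set (p, 0); (q, 0)]].

Lemma exists_marked_arc p q : M p -> M q -> p <> q ->
  ~ neighbours (@ccw R) M p q -> exists P, marked_arc P p q.
Proof.
move=> Mp Mq pq n.
have [||e|P [_ h]] := @exists_represents (p, 0) (q, 0).
- by left; exists p.
- by left; exists q.
- by case: e.
have [|iP eP] := h; last by exists P.
case=> [/(next_marking'_inv Mp Mq) h'|/(next_marking'_inv Mq Mp) h'].
  by apply: n; left.
by apply: n; right.
Qed.

Lemma susp_marked_arc P p q : marked_arc P p q ->
  exists p' q', marked_arc (susp P) p' q'.
Proof.
case=> iP Mp Mq pq eP; have iP1 := susp_indecomposable iP.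
have [p' np] := prev_marked hM Mp; have [q' nq] := prev_marked hM Mq.
have e := dcc_susp hC iP eP (next_marking' zeta hM np) (next_marking' zeta hM nq).
exists p', q'; split => //; [by case: np | by case: nq |] => pq'.
have [a [b [_ _ ab _]]] := indec_ends iP1; rewrite e pq' => h.
by case: (eq_set2 h) => -[ea eb]; apply: ab; rewrite -ea -eb.
Qed.

Lemma hom_dsum0 n (Y : 'I_n -> C) P X : is_dsum Y X ->
  (forall i, hom_is_0 P (Y i)) -> hom_is_0 P X.
Proof.
move=> [i [p [_ _ e]]] h f; rewrite -[f]lcomp1m -e lcomp_suml big1// => j _.
by rewrite -lcompA (h j (p j \lcom f)) lcomp0r.
Qed.

(** An arc P with both ends in M crosses no arc inside an added interval,
    whence Hom(P, Z[1]) = 0. By duality Hom(P, Z) is controlled by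
    Hom(Z, P[2]), and P[1] is again an arc with both ends in M. *)
Lemma marked_arc_perp P p q Z : marked_arc P p q -> added_subcategory M ell Z ->
  hom_is_0 P Z /\ hom_is_0 P (susp Z).
Proof.
move=> hP [n [Y [hY dY]]]; split.
  apply: hom_dsum0 dY _ => i; have [iY aY] := hY i.
  have [p' [q' [iP1 Mp Mq pq eP1]]] := susp_marked_arc hP.
  apply: two_CY_hom0; first exact: dcc_two_CY hC.
  apply: (dcc_hom_noncrossing hC) => //; rewrite eP1.
  by have [] := not_crosses_interval hM Mp Mq pq (fun a => @ell_in _ a iY) aY.
case: hP => iP Mp Mq pq eP.
have /hom_dsum0 : is_dsum (fun i => suspension C (Y i) : C) (suspension C Z).
  by apply: lmap_dsum dY; exact: shift_linear.
apply=> i; have [iY aY] := hY i; apply: (dcc_hom_noncrossing hC) => //; rewrite eP.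
by have [] := not_crosses_interval hM Mp Mq pq (fun a => @ell_in _ a iY) aY.
Qed.

Lemma quotient_hom_marked P p q X Y : marked_arc P p q -> isomorphic (Q X) (Q Y) ->
  exists phi : lhom P (susp X) -> lhom P (susp Y),
    (forall (t : k) u v, phi (t *: u + v) = t *: phi u + phi v) /\ bijective phi.
Proof.
by move=> hP; apply: (quotient_hom hQ) => Z; exact: (marked_arc_perp hP).
Qed.

Lemma crosses_hom P X : indecomposable P -> indecomposable X ->
  crosses (@ccw' R) (ell P) (ell X) <-> exists f : lhom P (susp X), f <> 0.
Proof.
move=> iP iX; split=> [/(dcc_hom_crossing hC iP iX) [phi [psi _ Kpsi]]|[f nz]].
  exists (psi 1) => e; have := Kpsi 1; rewrite e linear0 => /eqP.
  by rewrite eq_sym oner_eq0.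
by apply: contrapT => /(dcc_hom_noncrossing hC iP iX) h; apply: nz; exact: h.
Qed.

(** X is the cone of the map 0 -> X. *)
Lemma added_zero X : added_subcategory M ell X -> is_zero (Q X : Cbar).
Proof.
move=> hX; have [Z hZ] := zero_object C.
have hZ1 : is_zero (suspension C Z : C) by apply: lmap_zero => //; exact: shift_linear.
have t : dist (0 : lhom Z X) (lid X) (0 : lhom X (suspension C Z : C)).
  apply/dist_rotate; rewrite (lmap0 (@shift_linear k C)) oppr0; exact: dist_id.
have /hQ.1 h : cone_in (added_subcategory M ell) (0 : lhom Z X).
  by exists X, (lid X), 0.
by apply: (@iso_zero _ _ (Q Z)); [exists (Defs.fmap Q (0 : lhom Z X)) | exact: lmap_zero].
Qed.

Lemma added_of_interval X : indecomposable X -> in_added_interval M (ell X) ->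
  added_subcategory M ell X.
Proof.
move=> iX aX; exists 1%N, (fun=> X); split => //.
exists (fun=> lid X), (fun=> lid X); split.
- by move=> _; rewrite lcomp1m.
- by move=> i j; rewrite !ord1.
- by rewrite big_ord1 lcomp1m.
Qed.

Lemma quotient_zero X a b : indecomposable X -> ell X = [set a; b] -> a.1 = b.1 ->
  is_zero (Q X : Cbar).
Proof.
move=> iX eX e; apply/added_zero/added_of_interval => //.
have [a' [b' [Ma Mb ab _ eX']]] := indec_ends iX.
have e' : a'.1 = b'.1.
  by rewrite eX' in eX; case: (eq_set2 eX) => -[-> ->].
have [z [i [j [lz ea eb _]]]] := marking'_eq_fst hM Ma Mb e' ab.
exists z => // c; rewrite eX' ea eb => -[] /= -> /=; split => //; exact: (zeta_in hz).
Qed.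

(** The crossing arcs {a1, b} and {a2, a4}, where a4 comes just before a1, give
    a triangle {a1, b} -> {a2, b} -> {a2, a4} because {a4, a1} is a boundary
    segment; its cone {a2, a4} lies inside the added interval of z. *)
Lemma quotient_iso_added z i j b X Y : limit_point M z -> M' b -> b.1 <> z -> i < j ->
  indecomposable X -> ell X = [set (z, zeta z i); b] ->
  indecomposable Y -> ell Y = [set (z, zeta z j); b] ->
  isomorphic (Q X) (Q Y).
Proof.
move=> lz Mb bz ij iX eX iY eY.
set a1 := (z, zeta z i) in eX; set a2 := (z, zeta z j) in eY.
pose a4 := (z, zeta z (i - 1)).
have [M1 M2 M4] : [/\ M' a1, M' a2 & M' a4].
  by split; right; [exists z, i | exists z, j | exists z, (i - 1)].
have lt41 : before a4 a1 by split => //=; rewrite (zeta_lt hz)//; lia.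
have lt12 : before a1 a2 by split => //=; rewrite (zeta_lt hz).
have neq u v : before u v -> u <> v by case=> _ + e; rewrite e ltxx.
have neq1 u v : u.1 <> v.1 -> u <> v by move=> + e; rewrite e.
have cyc : cyc4 (@ccw' R) a1 a2 b a4.
  by split; [constructor 2 | constructor 4]; split => //; right.
have rX : represents (@ccw' R) M' ell a1 b X.
  by split => // /(added_not_neighbours hz lz bz).
have rY : represents (@ccw' R) M' ell a2 b Y.
  by split => // /(added_not_neighbours hz lz bz).
have n24 := added_not_neighbours_interval hz lz ij.
have [XA rA] : exists XA, represents (@ccw' R) M' ell a1 a2 XA.
  by apply: exists_represents => //; exact: neq.
have [W rW] : exists W, represents (@ccw' R) M' ell a2 a4 W.
  apply: exists_represents => // e; move: lt12; rewrite e => -[_ l].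
  by case: lt41 => _ l'; have := lt_trans l l'; rewrite ltxx.
have [XC rC] : exists XC, represents (@ccw' R) M' ell b a4 XC.
  by apply: exists_represents => //; exact: neq1.
have [XD rD] : exists XD, represents (@ccw' R) M' ell a4 a1 XD.
  by apply: exists_represents => //; exact: neq.
have zD : is_zero XD by apply: rD.1; left; exact: added_next.
have [BD [AC [dB _ [f [g [h [fgh _]]]] _]]] :=
  dcc_triangles hC M1 M2 Mb M4 cyc rX rW rA rY rC rD.
have [iW eW] := rW.2 n24.
have /hQ.1 fiso : cone_in (added_subcategory M ell) f.
  exists W, g, h; split => //; apply: added_of_interval => //.
  by exists z => // c; rewrite eW => -[] /= -> /=; split => //; exact: (zeta_in hz).
apply: (@isomorphic_trans _ _ (Q BD)); first by exists (Defs.fmap Q f).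
apply/isomorphic_sym/isomorphic_fun; exact: dsum2_zeror dB.
Qed.

Lemma quotient_iso_move a a' b X Y :
  M' a -> M' a' -> M' b -> a.1 = a'.1 -> a.1 <> b.1 ->
  indecomposable X -> ell X = [set a; b] ->
  indecomposable Y -> ell Y = [set a'; b] ->
  isomorphic (Q X) (Q Y).
Proof.
move=> Ma Ma' Mb e ab iX eX iY eY.
have [aa'|aa'] := pselect (a = a').
  by apply/isomorphic_fun/iso_of_ell => //; rewrite eX eY aa'.
have [z [i [j [lz ea ea' ij]]]] := marking'_eq_fst hM Ma Ma' e aa'.
have bz : b.1 <> z by move=> E; apply: ab; rewrite E ea.
move: ij; rewrite neq_lt => /orP[ij|ij].
  by apply: (@quotient_iso_added z i j b) => //; rewrite -?ea -?ea'.
by apply: isomorphic_sym; apply: (@quotient_iso_added z j i b) => //; rewrite -?ea -?ea'.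
Qed.

Lemma neighbours_fst a b : M' a -> M' b -> a.1 <> b.1 ->
  ~ neighbours (@ccw' R) M' a b <-> ~ neighbours (@ccw R) M a.1 b.1.
Proof.
move=> Ma Mb ab; split=> n h; apply: n.
  case: h => h; have [M1 M2 _ _] := h.
    by left; rewrite (marking'_marked hM Ma M1) (marking'_marked hM Mb M2);
      exact: next_marking'.
  by right; rewrite (marking'_marked hM Ma M2) (marking'_marked hM Mb M1);
    exact: next_marking'.
have lim c d : M' c -> d.1 <> c.1 -> neighbours (@ccw' R) M' c d -> M c.1.
  move=> Mc dc; case: (marking'P Mc) => [[]//|[lc [j ec]]].
  by rewrite ec => /(added_not_neighbours hz lc dc).
have M1 : M a.1 by apply: lim h => //; exact: nesym.
have M2 : M b.1 by apply: (@lim b a) => //; case: h; [right | left].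
move: h; rewrite (marking'_marked hM Ma M1) (marking'_marked hM Mb M2) /=.
by case=> h; [left | right]; exact: next_marking'_inv h.
Qed.

Lemma quotient_iso_of_fst a b a' b' X Y :
  M' a -> M' a' -> M' b -> M' b' -> a.1 <> b.1 ->
  a.1 = a'.1 -> b.1 = b'.1 ->
  indecomposable X -> ell X = [set a; b] ->
  indecomposable Y -> ell Y = [set a'; b'] ->
  isomorphic (Q X) (Q Y).
Proof.
move=> Ma Ma' Mb Mb' ab ea eb iX eX iY eY.
have a'b : a'.1 <> b.1 by rewrite -ea.
have [|W [_ rW]] := @exists_represents a' b Ma' Mb.
  by move=> E; apply: a'b; rewrite E.
have [|iW eW] := rW.
  apply/(neighbours_fst Ma' Mb a'b); rewrite -ea.
  apply/(neighbours_fst Ma Mb ab).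
  exact: ends_not_neighbours eX.
apply: (@isomorphic_trans _ _ (Q W)); first exact: (@quotient_iso_move a a' b).
apply: (@quotient_iso_move b b' a') => //; first exact: nesym.
  by rewrite eW setUC.
by rewrite eY setUC.
Qed.

Lemma exists_separating a b c d X : M' a -> M' b -> M' c -> M' d -> a.1 <> b.1 ->
  indecomposable X -> ell X = [set a; b] -> a.1 <> c.1 -> a.1 <> d.1 ->
  exists P p q, [/\ marked_arc P p q, crosses (@ccw' R) (ell P) (ell X) &
    ~ crosses (@ccw' R) (ell P) [set c; d]].
Proof.
move=> Ma Mb Mc Md ab iX eX ac ad.
have nab : ~ neighbours (@ccw R) M a.1 b.1.
  apply/(neighbours_fst Ma Mb ab).
  exact: ends_not_neighbours eX.
have [p [q [Mp Mq pq npq [s1 s2]]]] := separating_arc hM (marking'_closure Ma)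
  (marking'_closure Mb) (marking'_closure Mc) (marking'_closure Md) ab nab ac ad.
have [P hP] := exists_marked_arc Mp Mq pq npq; exists P, p, q.
case: (hP) => _ _ _ _ ->; split => //.
  by rewrite eX; apply/(crossesP hM Mp Mq pq Ma Mb).
by move=> /(crossesP hM Mp Mq pq Mc Md).
Qed.

Lemma fst_ends_of_crossings a b c d X Y : M' a -> M' b -> M' c -> M' d -> a.1 <> b.1 ->
  indecomposable X -> ell X = [set a; b] ->
  indecomposable Y -> ell Y = [set c; d] ->
  (forall P p q, marked_arc P p q ->
     crosses (@ccw' R) (ell P) (ell X) -> crosses (@ccw' R) (ell P) (ell Y)) ->
  [set a.1; b.1] = [set c.1; d.1].
Proof.
move=> Ma Mb Mc Md ab iX eX iY eY h.
have mem u v : M' u -> M' v -> u.1 <> v.1 -> ell X = [set u; v] ->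
    u.1 = c.1 \/ u.1 = d.1.
  move=> Mu Mv uv e; have [uc|uc] := pselect (u.1 = c.1); first by left.
  have [ud|ud] := pselect (u.1 = d.1); first by right.
  have [P [p [q [hP c1 c2]]]] := exists_separating Mu Mv Mc Md uv iX e uc ud.
  by case: c2; rewrite -eY; exact: h hP c1.
have eX' : ell X = [set b; a] by rewrite setUC.
have [ea|ea] := mem a b Ma Mb ab eX; have [eb|eb] := mem b a Mb Ma (nesym ab) eX'.
- by case: ab; rewrite ea eb.
- by rewrite ea eb.
- by rewrite ea eb setUC.
- by case: ab; rewrite ea eb.
Qed.

Lemma exists_crossing a b X : M' a -> M' b -> a.1 <> b.1 ->
  indecomposable X -> ell X = [set a; b] ->
  exists P p q, marked_arc P p q /\ crosses (@ccw' R) (ell P) (ell X).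
Proof.
move=> Ma Mb ab iX eX.
have [P [p [q [hP h _]]]] := exists_separating Ma Mb Mb Mb ab iX eX ab ab.
by exists P, p, q.
Qed.

(** Some arc P with both ends in M crosses X, so Hom(P, X[1]) does not vanish. *)
Lemma quotient_nonzero a b X : M' a -> M' b -> a.1 <> b.1 ->
  indecomposable X -> ell X = [set a; b] -> ~ is_zero (Q X : Cbar).
Proof.
move=> Ma Mb ab iX eX zX.
have [P [p [q [hP /crosses_hom h]]]] := exists_crossing Ma Mb ab iX eX.
have [||f nz] := h => //; first by case: hP.
have [Z hZ] := zero_object C.
have XZ : isomorphic (Q X) (Q Z) by apply: zero_iso => //; exact: lmap_zero.
have [phi [_ [psi phiK _]]] := quotient_hom_marked hP XZ.
have hZ1 : is_zero (susp Z) by apply: lmap_zero => //; exact: shift_linear.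
apply: nz; apply: (can_inj phiK).
by rewrite (to_zero (phi f) hZ1) (to_zero (phi 0) hZ1).
Qed.

Lemma nonzero_ends X : indecomposable X -> ~ is_zero (Q X : Cbar) ->
  exists a b, [/\ M' a, M' b, a.1 <> b.1 & ell X = [set a; b]].
Proof.
move=> iX nz; have [a [b [Ma Mb _ _ eX]]] := indec_ends iX; exists a, b; split => //.
by move=> e; apply: nz; exact: quotient_zero eX e.
Qed.

Lemma krull_schmidt_indec X : exists n (Y : 'I_n -> C),
  (forall i, indecomposable (Y i)) /\ is_dsum Y X.
Proof.
have [n [Y [hY dY]]] := dcc_krull_schmidt hC X.
by exists n, Y; split => // i; exact: local_end_indecomposable.
Qed.

(** In a decomposition of X, one summand after the other dies in the quotient
    until one of them is the whole of Q X. *)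
Lemma quotient_indec_summand n (Y : 'I_n -> C) X : is_dsum Y X ->
  indecomposable (Q X : Cbar) -> exists i, isomorphic (Q X) (Q (Y i)).
Proof.
elim: n => [|n IHn] in Y X *; move=> dY iX.
  by case: iX => + _; case; apply: dsum_zero (lmap_dsum hQlin dY) => -[].
have [T dT] := tadditive (fun j => Y (lift ord0 j)).
have dX := dsum_split dY dT.
have := lmap_dsum2 hQlin dX; case: (iX) => _ h /[dup] dQ /h [] z.
  have TX : isomorphic (Q T) (Q X) by exact: dsum2_zerol dQ.
  have iT := iso_indecomposable (isomorphic_sym TX) iX.
  have [i hi] := IHn _ _ dT iT; exists (lift ord0 i).
  exact: isomorphic_trans (isomorphic_sym TX) hi.
by exists ord0; apply: isomorphic_sym; exact: dsum2_zeror dQ.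
Qed.

Lemma quotient_indec_lift (Y : Cbar) : indecomposable Y ->
  exists2 X, indecomposable X & isomorphic (Y : cat_of Cbar) (Q X).
Proof.
move=> iY; have [X YX] := localization_ess_surj hQ Y.
have [n [Z [iZ dZ]]] := krull_schmidt_indec X.
have [i hi] := quotient_indec_summand dZ (iso_indecomposable YX iY).
by exists (Z i) => //; exact: isomorphic_trans YX hi.
Qed.

Lemma nonzero_retract X : ~ is_zero (Q X : Cbar) ->
  exists Y (i : lhom Y X) (r : lhom X Y),
    [/\ indecomposable Y, ~ is_zero (Q Y : Cbar) & r \lcom i = lid Y].
Proof.
move=> nz; have [n [Y [iY dY]]] := krull_schmidt_indec X.
have [j zj] : exists j, ~ is_zero (Q (Y j) : Cbar).
  apply: contrapT => h; apply: nz; apply: dsum_zero (lmap_dsum hQlin dY) => j.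
  by apply: contrapT => hj; apply: h; exists j.
by case: dY => i [r [h _ _]]; exists (Y j), (i j), (r j).
Qed.

(** Suppose that X becomes A + B with A and B nonzero. Each of them contains
    the image of an indecomposable Y1, resp. Y2. Every marked arc crossing Y1
    or Y2 must cross X, so that Y1, Y2 and X project to the same arc. A marked
    arc P crossing it would make Hom(P, X[1]), which is one-dimensional,
    contain Hom(P, Y1[1]) + Hom(P, Y2[1]), which is two-dimensional. *)
Lemma quotient_indecomposable X : indecomposable X -> ~ is_zero (Q X : Cbar) ->
  indecomposable (Q X : Cbar).
Proof.
move=> iX nz; split => // A B dAB; apply: contrapT => /not_orP [nA nB].
have [a [b [Ma Mb ab eX]]] := nonzero_ends iX nz.
have [XA hA] := localization_ess_surj hQ A; have [XB hB] := localization_ess_surj hQ B.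
have nzA : ~ is_zero (Q XA : Cbar).
  by move=> z; apply: nA; apply: iso_zero z; exact: isomorphic_sym.
have nzB : ~ is_zero (Q XB : Cbar).
  by move=> z; apply: nB; apply: iso_zero z; exact: isomorphic_sym.
have [S dS] := tadditive (fun x : bool => if x then XA else XB).
have SX : isomorphic (Q S) (Q X).
  apply: dsum2_uniq (lmap_dsum2 hQlin dS) _.
  exact: dsum2_iso hA hB (isomorphic_refl _) dAB.
have [i [j [r [s [h1 h2 h3 h4 _]]]]] := (dsum2P XA XB S).1 dS.
have [Y1 [i1 [r1 [iY1 nz1 e1]]]] := nonzero_retract nzA.
have [Y2 [i2 [r2 [iY2 nz2 e2]]]] := nonzero_retract nzB.
pose m1 := i \lcom i1; pose m2 := j \lcom i2.
pose n1 := r1 \lcom r; pose n2 := r2 \lcom s.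
have mid (T1 T2 T3 T4 : C) (x : lhom T1 T2) (y : lhom S T1) (z : lhom T3 S)
    (w : lhom T4 T3) :
    (x \lcom y) \lcom (z \lcom w) = x \lcom (y \lcom z) \lcom w by rewrite !lcompA.
have n1m1 : n1 \lcom m1 = lid Y1 by rewrite mid h1 lcompm1.
have n2m2 : n2 \lcom m2 = lid Y2 by rewrite mid h2 lcompm1.
have n1m2 : n1 \lcom m2 = 0 by rewrite mid h4 lcomp0r lcomp0l.
have sl := @shift_linear k C.
have retract T (m : lhom T S) (n : lhom S T) P (f : lhom P (susp T)) :
    n \lcom m = lid T ->
    lmap (suspension C) n \lcom (lmap (suspension C) m \lcom f) = f.
  by move=> e; rewrite lcompA -lmap_comp e lmap_id lcomp1m.
have sub T (m : lhom T S) (n : lhom S T) : indecomposable T -> ~ is_zero (Q T : Cbar) ->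
    n \lcom m = lid T -> forall P p q, marked_arc P p q ->
    crosses (@ccw' R) (ell P) (ell X) -> crosses (@ccw' R) (ell P) (ell T).
  move=> iT nzT e; have [c [d [Mc Md cd eT]]] := nonzero_ends iT nzT.
  have ends : [set c.1; d.1] = [set a.1; b.1].
    apply: (fst_ends_of_crossings Mc Md Ma Mb cd iT eT iX eX) => P p q hP cT.
    have iP : indecomposable P by case: hP.
    have [f nf] := (crosses_hom iP iT).1 cT.
    have [phi [phi_lin [psi phiK _]]] := quotient_hom_marked hP SX.
    apply/(crosses_hom iP iX); exists (phi (lmap (suspension C) m \lcom f)) => e0.
    apply: nf; rewrite -(retract _ _ _ _ f e).
    suff -> : lmap (suspension C) m \lcom f = 0 by rewrite lcomp0r.
    by apply: (can_inj phiK); rewrite e0 (linear_at0 phi_lin).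
  move=> P p q [_ Mp Mq pq eP]; rewrite eP eX eT.
  move=> /(crossesP hM Mp Mq pq Ma Mb) h; apply/(crossesP hM Mp Mq pq Mc Md).
  case: (eq_set2 ends) => -[-> ->] //; case: h => h; [by right | by left].
have [P [p [q [hP cX]]]] := exists_crossing Ma Mb ab iX eX.
have iP : indecomposable P by case: hP.
have [f1 nf1] := (crosses_hom iP iY1).1 (sub _ _ _ iY1 nz1 n1m1 _ _ _ hP cX).
have [f2 nf2] := (crosses_hom iP iY2).1 (sub _ _ _ iY2 nz2 n2m2 _ _ _ hP cX).
have [phi [phi_lin [psi phiK _]]] := quotient_hom_marked hP SX.
have [chi [chi' chiK _]] := dcc_hom_crossing hC iP iX cX.
pose theta g := chi (phi g).
have theta_lin (t : k) u v : theta (t *: u + v) = t * theta u + theta v.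
  by rewrite /theta phi_lin linearP.
have theta_inj : injective theta.
  by apply: inj_comp; [exact: can_inj chiK | exact: can_inj phiK].
pose g1 := lmap (suspension C) m1 \lcom f1; pose g2 := lmap (suspension C) m2 \lcom f2.
have dep : theta g2 *: g1 + 0 = theta g1 *: g2 + 0.
  by apply: theta_inj; rewrite !theta_lin mulrC.
have g2_nz : theta g2 != 0.
  apply/eqP => e; apply: nf2.
  have : g2 = 0.
    by apply: theta_inj; rewrite e (@linear_at0 _ _ k^o _ theta_lin).
  by move=> e0; rewrite -(retract _ _ _ _ f2 n2m2) -/g2 e0 lcomp0r.
apply: nf1; have : lmap (suspension C) n1 \lcom (theta g2 *: g1) = 0.
  move: dep; rewrite !addr0 => ->; rewrite lcompZr /g2 lcompA -lmap_comp n1m2.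
  by rewrite lmap0// lcomp0l scaler0.
rewrite lcompZr /g1 retract// => /eqP.
by rewrite scaler_eq0 (negbTE g2_nz) => /eqP.
Qed.

(** Isomorphic images are crossed by the same marked arcs, hence project to the
    same arc. *)
Lemma quotient_iso_ends X Y : indecomposable X -> indecomposable Y ->
  ~ is_zero (Q X : Cbar) -> ~ is_zero (Q Y : Cbar) ->
  (isomorphic (Q X) (Q Y) <-> fst @` ell X = fst @` ell Y).
Proof.
move=> iX iY nX nY.
have [a [b [Ma Mb ab eX]]] := nonzero_ends iX nX.
have [c [d [Mc Md cd eY]]] := nonzero_ends iY nY.
rewrite eX eY !image_set2; split=> [XY|ends]; last first.
  case: (eq_set2 ends) => -[e1 e2]; first exact: (@quotient_iso_of_fst a b c d).
  by apply: (@quotient_iso_of_fst a b d c) => //; rewrite eY setUC.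
apply: (fst_ends_of_crossings Ma Mb Mc Md ab iX eX iY eY) => P p q hP cX.
have iP : indecomposable P by case: hP.
have [f nf] := (crosses_hom iP iX).1 cX.
have [phi [phi_lin [psi phiK _]]] := quotient_hom_marked hP XY.
apply/(crosses_hom iP iY); exists (phi f) => e; apply: nf.
by apply: (can_inj phiK); rewrite e (linear_at0 phi_lin).
Qed.

Lemma quotient_ends_arc X : indecomposable X -> ~ is_zero (Q X : Cbar) ->
  arcs (@ccw R) M Mbar (fst @` ell X).
Proof.
move=> iX nX; have [a [b [Ma Mb ab eX]]] := nonzero_ends iX nX.
exists a.1, b.1; rewrite eX image_set2; split => //.
- exact: marking'_closure Ma.
- exact: marking'_closure Mb.
apply/(neighbours_fst Ma Mb ab).
exact: ends_not_neighbours eX.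
Qed.

Lemma arc_quotient_ends l : arcs (@ccw R) M Mbar l ->
  exists X, [/\ indecomposable X, ~ is_zero (Q X : Cbar) & fst @` ell X = l].
Proof.
case=> x [y [Mx My xy nxy ->]].
have [a Ma ea] := closure_lift zeta Mx; have [b Mb eb] := closure_lift zeta My.
have ab : a.1 <> b.1 by rewrite ea eb.
have [|X [_ rX]] := exists_represents Ma Mb; first by move=> e; apply: ab; rewrite e.
have [|iX eX] := rX; first by apply/(neighbours_fst Ma Mb ab); rewrite ea eb.
by exists X; split => //; [exact: quotient_nonzero eX | rewrite eX image_set2 ea eb].
Qed.

(** All the X allowed here have the same projected arc; the union over them
    avoids choosing one. *)
Definition quotient_arc (Y : Cbar) : set pt :=
  [set x | exists X, [/\ indecomposable X, ~ is_zero (Q X : Cbar),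
     isomorphic (Y : cat_of Cbar) (Q X) & (fst @` ell X) x]].

Lemma quotient_arcE (Y : Cbar) X : indecomposable X -> ~ is_zero (Q X : Cbar) ->
  isomorphic (Y : cat_of Cbar) (Q X) -> quotient_arc Y = fst @` ell X.
Proof.
move=> iX nX YX; apply/seteqP; split=> [x [X' [iX' nX' YX' h]]|x h].
  have /(quotient_iso_ends iX iX' nX nX') -> // : isomorphic (Q X) (Q X').
  exact: isomorphic_trans (isomorphic_sym YX) YX'.
by exists X.
Qed.

Lemma quotient_arc_indec (Y : Cbar) : indecomposable Y ->
  exists X, [/\ indecomposable X, ~ is_zero (Q X : Cbar) &
    isomorphic (Y : cat_of Cbar) (Q X)].
Proof.
move=> iY; have [X iX YX] := quotient_indec_lift iY; exists X; split => // z.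
by case: iY => + _; apply; apply: iso_zero z; exact: isomorphic_sym.
Qed.

Lemma quotient_arc_bij : indec_bij (arcs (@ccw R) M Mbar) quotient_arc.
Proof.
split=> [Y /quotient_arc_indec [X [iX nX YX]]|Y Y' iY iY'|l hl].
- by rewrite (quotient_arcE iX nX YX); exact: quotient_ends_arc.
- have [X [iX nX YX]] := quotient_arc_indec iY.
  have [X' [iX' nX' YX']] := quotient_arc_indec iY'.
  rewrite (quotient_arcE iX nX YX) (quotient_arcE iX' nX' YX').
  rewrite -quotient_iso_ends//; split=> h.
    by apply: isomorphic_trans YX _; apply: isomorphic_trans h _; exact: isomorphic_sym.
  apply: isomorphic_trans (isomorphic_sym YX) _.
  exact: isomorphic_trans h YX'.
- have [X [iX nX <-]] := arc_quotient_ends hl; exists (Q X).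
    exact: quotient_indecomposable.
  by apply: quotient_arcE => //; exact: isomorphic_refl.
Qed.

End ClusterQuotient.

Theorem corollary3p11 (R : realType) (k : closedFieldType)
    (M : set (R * R)) (zeta : R * R -> int -> R)
    (C : triangulated k) (ell : C -> set (R * R * R))
    (Cbar : lincat k) (Q : functor C Cbar)
    (hM : admissible_marking M)
    (hzeta : added_points M zeta)
    (hC : is_discrete_cluster_category (@ccw' R) (marking' M zeta) ell)
    (hQlin : is_linear Q)
    (hQ : is_localization Q (cone_in (added_subcategory M ell))) :
  exists ellbar : Cbar -> set (R * R),
    indec_bij (arcs (@ccw R) M (M `|` limit_point M)) ellbar /\
    (* ellbar is induced by collapsing each added interval to its point *)
    forall X : C, indecomposable X -> indecomposable (Q X : Cbar) ->
      ellbar (Q X) = fst @` ell X.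
Proof.
exists (quotient_arc ell Q); split.
  exact: (quotient_arc_bij hM hzeta hC hQlin hQ).
move=> X iX [nX _]; apply: (quotient_arcE hM hzeta hC hQlin hQ) => //.
exact: isomorphic_refl.
Qed.
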